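(* Let $(\theta_n)_{n=1}^\infty\subset(0,1)$ be a regular null sequence, put $\theta=\sup_n\theta_n^{1/n}$ and $\varphi_n=\theta_n/\theta^n$, and assume $\theta<1$. If $$0<\inf_n\varphi_n\le\sup_n\varphi_n<1,$$ then the mixed Tsirelson space $X=T[(\mathcal{S}_n,\theta_n)_{n=1}^\infty]$ is not isomorphic (linearly homeomorphic) to the modified mixed Tsirelson space $X_M=T_M[(\mathcal{S}_n,\theta_n)_{n=1}^\infty]$.
   Context: A sequence $(\theta_n)$ in $(0,1)$ is regular if it is nonincreasing and $\theta_{m+n}\ge\theta_m\theta_n$ for all $m,n\in\mathbb{N}$; then $\lim_n\theta_n^{1/n}=\sup_n\theta_n^{1/n}$. For nonempty finite $I,J\subset\mathbb{N}$, $I<J$ means $\max I<\min J$. Schreier families: $\mathcal{S}_0$ consists of all singletons of $\mathbb{N}=\{1,2,\dots\}$ and $\emptyset$; for $n\ge1$, $\mathcal{S}_n$ consists of $\emptyset$ and all sets $\bigcup_{i=1}^kG_i$ with $G_i\in\mathcal{S}_{n-1}$ nonempty, $G_1<\dots<G_k$ and $k\le\min G_1$. A finite sequence $(E_i)_{i=1}^k$ of nonempty finite subsets of $\mathbb{N}$ is $\mathcal{S}_n$-admissible if $E_1<\dots<E_k$ and $\{\min E_i\}_{i=1}^k\in\mathcal{S}_n$; it is $\mathcal{S}_n$-allowable if the $E_i$ are pairwise disjoint and $\{\min E_i\}_{i=1}^k\in\mathcal{S}_n$. $c_{00}$ is the space of finitely supported real sequences; $Ex$ is the coordinatewise product of $x$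 with the indicator of $E$; $\|\cdot\|_{c_0}$ is the sup norm. Put $\|x\|_0=\|x\|_{c_0}$ and $\|x\|_{m+1}=\max\{\|x\|_m,\ \sup_n\theta_n\sup\sum_{i=1}^r\|E_ix\|_m\}$, the inner sup being over all $\mathcal{S}_n$-admissible $(E_i)_{i=1}^r$; $\|x\|=\lim_m\|x\|_m$. The norm $\|\cdot\|_{X_M}$ is defined in the same way with $\mathcal{S}_n$-allowable in place of $\mathcal{S}_n$-admissible. $T[(\mathcal{S}_n,\theta_n)_{n=1}^\infty]$ and $T_M[(\mathcal{S}_n,\theta_n)_{n=1}^\infty]$ are the completions of $c_{00}$ under $\|\cdot\|$ and $\|\cdot\|_{X_M}$ respectively. *)

(* Defs.v *)
From HB Require Import structures.
From mathcomp Require Import all_boot all_order all_algebra.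
From mathcomp Require Import finmap.
From mathcomp Require Import all_classical all_reals all_analysis.

Set Implicit Arguments.
Unset Strict Implicit.
Unset Printing Implicit Defensive.

Import Order.TTheory GRing.Theory Num.Theory numFieldNormedType.Exports.

Local Open Scope classical_set_scope.
Local Open Scope ring_scope.

(* Conventions. The index set is {1, 2, ...}: sets of indices are finite sets  *)
(* of naturals not containing 0, scalar sequences are functions on nat         *)
(* vanishing at 0, and the value at 0 of the sequence theta is never used.     *)

Section FiniteSets.

Implicit Types (E F G : {fset nat}) (Es Gs : seq {fset nat}).

Definition nonempty_index_set E : bool := (E != fset0) && (0%N \notin E).

Definition fmax E : nat := \max_(i <- E) i.

(* The default value fmax E is absorbed as soon as E is nonempty. *)
Definition fmin E : nat := \big[minn/fmax E]_(i <- E) i.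

Definition fset_before E F : bool := (fmax E < fmin F)%N.

Fixpoint schreier (n : nat) (F : {fset nat}) : Prop :=
  if n is n'.+1 then
    F = fset0 \/
    exists G Gs,
      [/\ forall H, H \in G :: Gs -> nonempty_index_set H /\ schreier n' H,
          sorted fset_before (G :: Gs),
          (size (G :: Gs) <= fmin G)%N
        & F = (\bigcup_(H <- G :: Gs) H)%fset]
  else F = fset0 \/ exists i : nat, (0 < i)%N /\ F = [fset i]%fset.

Definition min_set Es : {fset nat} := [fset i in map fmin Es]%fset.

Definition admissible (n : nat) Es : Prop :=
  [/\ all nonempty_index_set Es,
      sorted fset_before Es
    & schreier n (min_set Es)].

Definition allowable (n : nat) Es : Prop :=
  [/\ all nonempty_index_set Es,
      pairwise (fun E F => [disjoint E & F]%fset) Es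
    & schreier n (min_set Es)].

End FiniteSets.

Section FinitelySupported.

Variable R : realType.

Definition finsupp_pred : {pred nat -> R} :=
  [pred x | `[< x 0%N = 0 /\ finite_set [set n | x n != 0] >]].

Lemma finsupp_predP (x : nat -> R) :
  reflect (x 0%N = 0 /\ finite_set [set n | x n != 0]) (x \in finsupp_pred).
Proof. exact: asboolP. Qed.

Lemma finsupp_submod_closed : submod_closed finsupp_pred.
Proof.
split.
  apply/finsupp_predP; split=> //.
  suff -> : [set n | (0 : nat -> R) n != 0] = set0 by exact: finite_set0.
  by apply/seteqP; split=> n //=; rewrite eqxx.
move=> a x y /finsupp_predP[x0 fx] /finsupp_predP[y0 fy].
apply/finsupp_predP; split.
  have -> : (a *: x + y) 0%N = a * x 0%N + y 0%N by [].
  by rewrite x0 y0 mulr0 addr0.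
apply: (@sub_finite_set _ _ ([set n | x n != 0] `|` [set n | y n != 0])); last first.
  by rewrite finite_setU.
move=> n /=.
have -> : (a *: x + y) n = a * x n + y n by [].
have [->|xn _] := eqVneq (x n) 0; last by left.
by rewrite mulr0 add0r => yn; right.
Qed.

HB.instance Definition _ :=
  GRing.isSubmodClosed.Build R (nat -> R) finsupp_pred finsupp_submod_closed.

Record c00 := C00 { c00_seq :> nat -> R; c00_seqP : c00_seq \in finsupp_pred }.

HB.instance Definition _ := [isSub for c00_seq].
HB.instance Definition _ := [Choice of c00 by <:].
HB.instance Definition _ := [SubChoice_isSubLmodule of c00 by <:].

End FinitelySupported.

Section Norms.

Variable R : realType.

Definition fset_restrict (E : {fset nat}) (x : nat -> R) : nat -> R :=
  fun n => (n \in E)%:R * x n.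

Definition sup_norm (x : nat -> R) : R := sup [set `|x n| | n in setT].

(* fam n is the collection of families (E_1, ..., E_r) allowed at level n. On  *)
(* finitely supported sequences every supremum below is over a nonempty set    *)
(* bounded by the l^1 norm, so that the real-valued sup is the true supremum.  *)
Fixpoint norm_iter (fam : nat -> seq {fset nat} -> Prop) (theta : nat -> R)
    (m : nat) (x : nat -> R) : R :=
  if m is m'.+1 then
    Num.max (norm_iter fam theta m' x)
      (sup [set theta n *
                sup [set \sum_(E <- Es)
                           norm_iter fam theta m' (fset_restrict E x)
                    | Es in fam n]
           | n in [set n | (0 < n)%N]])
  else sup_norm x.

Definition limit_norm fam theta (x : nat -> R) : R :=
  limn (fun m => norm_iter fam theta m x).

Definition tsirelson_norm (theta : nat -> R) (x : c00 R) : R :=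
  limit_norm admissible theta x.

Definition modified_tsirelson_norm (theta : nat -> R) (x : c00 R) : R :=
  limit_norm allowable theta x.

End Norms.

(* (X, i) is a completion of V under the norm N; completions are unique up to  *)
(* isometric isomorphism.                                                      *)
Definition is_completion (R : realType) (V : lmodType R) (N : V -> R)
    (X : completeNormedModType R) (i : {linear V -> X}) : Prop :=
  (forall v, `|i v| = N v) /\ dense (range i).

Definition is_mixed_tsirelson (R : realType) (theta : nat -> R)
    (X : completeNormedModType R) : Prop :=
  exists i : {linear c00 R -> X}, is_completion (tsirelson_norm theta) i.

Definition is_modified_mixed_tsirelson (R : realType) (theta : nat -> R)
    (X : completeNormedModType R) : Prop :=
  exists i : {linear c00 R -> X},
    is_completion (modified_tsirelson_norm theta) i.

Definition isomorphic (R : realType) (X Y : normedModType R) : Prop :=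
  exists (f : {linear X -> Y}) (g : {linear Y -> X}),
    [/\ cancel f g, cancel g f, continuous f & continuous g].

Section Regular.

Variable R : realType.
Implicit Type theta : nat -> R.

Definition regular theta : Prop :=
  [/\ forall n, (0 < n)%N -> 0 < theta n < 1,
      forall m n, (0 < m)%N -> (m <= n)%N -> theta n <= theta m
    & forall m n, (0 < m)%N -> (0 < n)%N ->
        theta m * theta n <= theta (m + n)%N].

Definition root_sup theta : R :=
  sup [set theta n `^ n%:R^-1 | n in [set n | (0 < n)%N]].

Definition phi theta (n : nat) : R := theta n / root_sup theta ^+ n.

Definition phi_values theta : set R :=
  [set phi theta n | n in [set n | (0 < n)%N]].

End Regular.

(* Main.v *)
Require Import Defs.
From HB Require Import structures.
From mathcomp Require Import all_boot all_order all_algebra.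
From mathcomp Require Import finmap.
From mathcomp Require Import all_classical all_reals all_analysis.
From mathcomp Require Import ring lra.

(* Write Theta = root_sup theta, c = inf phi and d = sup phi < 1, so that         *)
(* c Theta^n <= theta_n <= d Theta^n. A norming functional of X pays, besides     *)
(* Theta per level of depth, a factor at most d for each node of its tree. Build  *)
(* v by alternately adding a vector e_j - e_j' in front and taking r successive   *)
(* long averages (Theta M)^-1 (v_1 + ... + v_M) of far apart copies. The vectors  *)
(* added at different stages live at different depths, so a functional of X that  *)
(* sees several of them pays d at each one and the norm of v stays below          *)
(* 3 / (1 - d) + 1, whatever the number K of stages. The vectors added at one     *)
(* stage form a part of v on which an admissible family of a single depth gives   *)
(* at least c; an S_1-allowable family separates the K intertwined parts, so      *)
(* the modified norm is at least theta_1 c K.                                     *)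
(*                                                                                *)
(* For an arbitrary isomorphism X -> X_M, a pigeonhole argument on coordinates    *)
(* makes the images of suitable differences e_j - e_j' successive blocks up to    *)
(* small errors. Only the lower bound is needed in X_M, and it needs nothing from *)
(* the blocks but a lower bound on their norms and their position.                *)

(** On the side of X the control is a profile [b]: [split_bound n0 b v] bounds by [b m] what v
    yields at depth m, weighted by Theta^m, when it is cut by at most n0 families. The key step is
    [split_bound_average]: a long average shifts the profile one level deeper and puts about d B at
    depth 0, where B bounds the whole profile. A new difference of unit vectors adds 2 Theta^m,
    which is sizable only at small depths, and there the preceding r averages have gained the factor
    d. As (1 - d) B >= 3, this gain absorbs the addition ([attainable_rounds]), so the bound hardly
    grows with the number of rounds.

    On the side of X_M, [admissible_flatten] carries each part through an average: it goes one level
    deeper and keeps its lower bound delta. Finally [modified_norm_ge_parts] adds all the parts by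
    one S_1-allowable family.

    The vectors v in X and V in X_M are built in parallel with the same coefficients, V using the
    blocks of [exists_far_block] in place of the images T (e_j - e_j'). Thus T v stays close to V,
    and the boundedness of T fails for large K. *)

Set Implicit Arguments.
Unset Strict Implicit.
Unset Printing Implicit Defensive.

Import Order.TTheory GRing.Theory Num.Theory numFieldNormedType.Exports.
Local Open Scope classical_set_scope.
Local Open Scope ring_scope.

(** * Schreier families *)

Section SetLists.

Implicit Types (E F G : {fset nat}) (Es Gs : seq {fset nat}).

(* Unlike fset_before, this relation makes no exception for empty sets, so that *)
(* it survives intersection of the members of a list with a fixed set.          *)
Definition entirely_before E F : bool :=
  `[< forall x y, x \in E -> y \in F -> (x < y)%N >].

Lemma entirely_beforeP E F :
  reflect (forall x y, x \in E -> y \in F -> (x < y)%N) (entirely_before E F).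
Proof. exact: asboolP. Qed.

Lemma leq_fmax E x : x \in E -> (x <= fmax E)%N.
Proof. by move=> xE; apply: (@leq_bigmax_seq _ _ xpredT id). Qed.

Lemma bigminn_leq (s : seq nat) m x : x \in s -> (\big[minn/m]_(i <- s) i <= x)%N.
Proof.
elim: s => [//|a s IH]; rewrite big_cons inE => /orP[/eqP->|xs].
  exact: geq_minl.
by apply: leq_trans (geq_minr _ _) _; exact: IH.
Qed.

Lemma bigminn_mem (s : seq nat) m : \big[minn/m]_(i <- s) i \in m :: s.
Proof.
elim: s => [|a s IH]; first by rewrite big_nil mem_head.
rewrite big_cons /minn; case: ifP => _; first by rewrite !inE eqxx orbT.
by move: IH; rewrite !inE => /orP[->//|->]; rewrite !orbT.
Qed.

Lemma bigmaxn_mem (s : seq nat) : (0 < size s)%N -> \max_(i <- s) i \in s.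
Proof.
elim: s => [//|a [|b s] IH] _; first by rewrite big_seq1 mem_head.
rewrite big_cons /maxn; case: ifP => _; last by rewrite mem_head.
by rewrite inE IH ?orbT.
Qed.

Lemma fmin_leq E x : x \in E -> (fmin E <= x)%N.
Proof. exact: bigminn_leq. Qed.

Lemma fmax_in E : E != fset0 -> fmax E \in E.
Proof. by move=> E0; apply: bigmaxn_mem; rewrite cardfs_gt0. Qed.

Lemma fmin_in E : E != fset0 -> fmin E \in E.
Proof.
move=> /fmax_in EE; have := bigminn_mem (enum_fset E) (fmax E).
by rewrite inE => /orP[/eqP|//]; rewrite -/(fmin E) => ->.
Qed.

Lemma fset_before_entirely E F :
  E != fset0 -> F != fset0 -> fset_before E F = entirely_before E F.
Proof.
move=> E0 F0; apply/idP/entirely_beforeP => [EF x y xE yF|EF].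
  exact: leq_ltn_trans (leq_fmax xE) (leq_trans EF (fmin_leq yF)).
by apply: EF; [exact: fmax_in|exact: fmin_in].
Qed.

Lemma sorted_pairwise_before Es : all nonempty_index_set Es ->
  sorted fset_before Es = pairwise entirely_before Es.
Proof.
move=> Es0; have neq0 E : E \in Es -> E != fset0.
  by move=> /(allP Es0)/andP[].
have -> : sorted fset_before Es = sorted entirely_before Es.
  apply: (@eq_in_sorted _ [in Es]) => [E F EEs FEs|]; last exact/allP.
  by apply: fset_before_entirely; exact: neq0.
apply: (@sorted_pairwise_in _ [in Es]); last exact/allP.
move=> E F G EEs FEs GEs /entirely_beforeP FE /entirely_beforeP EG.
apply/entirely_beforeP => x y xF yG.
have /fset0Pn[z zE] := neq0 _ EEs.
exact: ltn_trans (FE _ _ xF zE) (EG _ _ zE yG).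
Qed.

(* An iterated-S_1 reading of admissibility: no nonemptiness, and the head of   *)
(* the family is replaced by all its members, which makes heredity immediate.   *)
Fixpoint weakly_admissible (m : nat) Es : Prop :=
  if m is m'.+1 then
    exists Gss : seq (seq {fset nat}),
      [/\ Es = flatten Gss,
          forall E x, E \in Es -> x \in E -> (size Gss <= x)%N
        & forall Gs, Gs \in Gss -> weakly_admissible m' Gs]
  else (size Es <= 1)%N.

Lemma weakly_admissible_fsetI m F Es : weakly_admissible m Es ->
  weakly_admissible m [seq E `&` F | E <- Es]%fset.
Proof.
elim: m Es => [|m IH] Es; first by rewrite /= size_map.
move=> [Gss [EsE szG admG]]; exists (map (map (fun E => E `&` F)%fset) Gss); split.
- by rewrite EsE map_flatten.
- by move=> E x /mapP[E' E'Es ->] /fsetIP[xE' _]; rewrite size_map; exact: szG xE'.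
- by move=> Gs /mapP[Gs' Gs'Gss ->]; exact/IH/admG.
Qed.

Lemma pairwise_before_fsetI F Es : pairwise entirely_before Es ->
  pairwise entirely_before [seq E `&` F | E <- Es]%fset.
Proof.
rewrite pairwise_map; apply: sub_pairwise => E G /entirely_beforeP EG.
by apply/entirely_beforeP => x y /fsetIP[xE _] /fsetIP[yG _]; exact: EG.
Qed.

Lemma min_setP Es x : reflect (exists2 E, E \in Es & x = fmin E) (x \in min_set Es).
Proof. by rewrite !inE; exact: mapP. Qed.

Lemma bigcup_fsetP Gs x :
  reflect (exists2 G, G \in Gs & x \in G) (x \in \bigcup_(G <- Gs) G)%fset.
Proof.
apply: (iffP (@bigfcupP _ _ Gs x id xpredT)) =>
    [[G /andP[GGs _] xG]|[G GGs xG]]; first by exists G.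
by exists G => //; rewrite GGs.
Qed.

(** As [f] increases along [s] and the cells are successive, the entries with key in the first cell
    form an initial segment; recursion on the cells splits off one segment at a time. *)
Lemma flatten_filter_cells (T : eqType) (f : T -> nat) (s : seq T) Gs :
  pairwise (fun x y => f x < f y)%N s -> pairwise entirely_before Gs ->
  (forall x, x \in s -> f x \in \bigcup_(G <- Gs) G)%fset ->
  s = flatten [seq [seq x <- s | f x \in G] | G <- Gs].
Proof.
move=> fs; elim: Gs s fs => [|G Gs IH] s fs.
  by case: s fs => // x s _ _ /(_ x (mem_head _ _)); rewrite big_nil inE.
rewrite pairwise_cons => /andP[GGs bGs] scov /=.
set t := [seq x <- s | f x \notin G].
have tE : t = flatten [seq [seq x <- s | f x \in H] | H <- Gs].
  rewrite [LHS](IH t) => //.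
  - congr flatten; apply/eq_in_map => H HGs.
    rewrite /t -filter_predI; apply/eq_filter => x /=.
    apply/andP/idP => [[]//|xH]; split=> //; apply/negP => xG.
    by move/allP: GGs => /(_ _ HGs)/entirely_beforeP/(_ _ _ xG xH); rewrite ltnn.
  - exact: pairwise_filter.
  - move=> x; rewrite mem_filter => /andP[xG /scov].
    by rewrite big_cons in_fsetU (negPf xG).
rewrite -tE /t.
have fG x y : x \in s -> y \in s -> f x \in G -> f y \notin G -> (f x < f y)%N.
  move=> _ ys xG yG; have := scov y ys; rewrite big_cons in_fsetU (negPf yG) /=.
  move=> /bigcup_fsetP[H HGs yH].
  by move/allP: GGs => /(_ _ HGs)/entirely_beforeP; apply.
elim: s fs fG {scov t tE IH} => [//|a s IH] /= /andP[/allP as_ fs] fG.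
have IHs : s = [seq x <- s | f x \in G] ++ [seq x <- s | f x \notin G].
  by apply: IH => // x y xs ys; apply: fG; rewrite inE ?xs ?ys orbT.
have [aG|aG] := boolP (f a \in G); first by rewrite cat_cons -IHs.
have sG0 : [seq x <- s | f x \in G] = [::].
  apply/eqP; rewrite -[_ == _]negbK -has_filter; apply/hasPn => x xs.
  apply/negP => xG; have := fG x a; rewrite inE xs orbT mem_head => /(_ isT isT xG aG).
  by move=> /ltn_trans /(_ (as_ _ xs)); rewrite ltnn.
by rewrite sG0 /=; congr cons; rewrite {1}IHs sG0.
Qed.

(** The pieces of the set of minima group the sets E by the piece that contains [fmin E]. Every
    point of every E is at least the minimum of the first piece, which bounds the number of
    groups. *)
Lemma schreier_weakly_admissible m Es :
  all nonempty_index_set Es -> pairwise entirely_before Es ->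
  schreier m (min_set Es) -> weakly_admissible m Es.
Proof.
elim: m Es => [|m IH] Es Es0 bEs.
  (* At depth 0 two successive sets would have distinct minima, too many for a singleton. *)
  move=> S0; case: Es Es0 bEs S0 => [//|E [//|F Es]] Es0 bEs /=.
  have EEF : fmin E \in min_set [:: E, F & Es].
    by apply/min_setP; exists E => //; exact: mem_head.
  have FEF : fmin F \in min_set [:: E, F & Es].
    by apply/min_setP; exists F => //; rewrite !inE eqxx orbT.
  case=> [S|[i [_ S]]]; first by move: EEF; rewrite S inE.
  move: EEF FEF; rewrite S !inE => /eqP Ei /eqP Fi.
  move: bEs => /= /andP[/andP[/entirely_beforeP EF _] _].
  move: Es0 => /= /and3P[/andP[E0 _] /andP[F0 _] _].
  by have := EF _ _ (fmin_in E0) (fmin_in F0); rewrite Ei Fi ltnn.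
have neq0 E : E \in Es -> E != fset0 by move=> /(allP Es0)/andP[].
have nil_case : Es = [::] -> weakly_admissible m.+1 Es.
  by move=> ->; exists [::].
case=> [S|[G [Gs [SG bG szG SE]]]].
  apply: nil_case; case: Es {IH bEs Es0 neq0} S => // E Es S.
  suff : fmin E \in min_set (E :: Es) by rewrite S inE.
  by apply/min_setP; exists E => //; exact: mem_head.
have Gs0 : all nonempty_index_set (G :: Gs) by apply/allP => H /SG[].
rewrite sorted_pairwise_before // in bG.
have fEs : pairwise (fun E F => fmin E < fmin F)%N Es.
  have allEs : all [in Es] Es by exact/allP.
  apply: (sub_in_pairwise _ allEs bEs) => E F EEs FEs /entirely_beforeP; apply.
    exact/fmin_in/neq0.
  exact/fmin_in/neq0.
have cov E : E \in Es -> fmin E \in (\bigcup_(H <- G :: Gs) H)%fset.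
  by move=> EEs; rewrite -SE; apply/min_setP; exists E.
exists [seq [seq E <- Es | fmin E \in H] | H <- G :: Gs]; split.
- exact: flatten_filter_cells.
- move=> E x EEs xE; rewrite size_map.
  apply: leq_trans szG (leq_trans _ (fmin_leq xE)).
  have /bigcup_fsetP[H] := cov _ EEs.
  have G0 : G != fset0 by have [/andP[]] := SG G (mem_head _ _).
  rewrite inE => /orP[/eqP->|HGs EH]; first exact: fmin_leq.
  apply/ltnW; move: bG; rewrite pairwise_cons => /andP[/allP/(_ _ HGs)].
  by move=> /entirely_beforeP GH _; apply: GH => //; exact: fmin_in.
- move=> _ /(@mapP {fset nat} (seq {fset nat}))[H HGs ->]; apply: IH.
  + by apply/allP => E; rewrite mem_filter => /andP[_ /(allP Es0)].
  + exact: pairwise_filter.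
  + have [_] := SG _ HGs; congr schreier; apply/fsetP => x.
    apply/idP/min_setP => [xH|[E]]; last by rewrite mem_filter => /andP[EH _] ->.
    have : x \in min_set Es by rewrite SE; apply/bigcup_fsetP; exists H.
    by move=> /min_setP[E EEs xE]; exists E => //; rewrite mem_filter EEs -xE xH.
Qed.

Lemma admissible_weakly m Es : admissible m Es ->
  weakly_admissible m Es /\ pairwise entirely_before Es.
Proof.
move=> [Es0 sEs SEs]; have bEs : pairwise entirely_before Es.
  by rewrite -sorted_pairwise_before.
by split=> //; exact: schreier_weakly_admissible.
Qed.

Lemma card_min_set_leq Es : (#|` min_set Es| <= size Es)%N.
Proof. by rewrite /min_set card_fseq (leq_trans (size_undup _)) // size_map. Qed.

Lemma schreier1 F : 0%N \notin F -> (#|` F| <= fmin F)%N -> schreier 1 F.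
Proof.
move=> F0 cF; set s := sort leq (enum_fset F).
have memF x : (x \in s) = (x \in F) by rewrite mem_sort.
have sF : size s = #|` F| by rewrite size_sort.
have nF : all nonempty_index_set [seq [fset x]%fset | x <- s].
  apply/allP => G /mapP[x]; rewrite memF => xF ->; apply/andP; split.
    by apply/fset0Pn; exists x; rewrite inE.
  by rewrite inE; apply: contraNneq F0 => ->.
have bF : pairwise entirely_before [seq [fset x]%fset | x <- s].
  have : pairwise ltn s.
    rewrite -(sorted_pairwise ltn_trans) ltn_sorted_uniq_leq sort_uniq fset_uniq /=.
    exact: (sort_sorted leq_total).
  rewrite pairwise_map; apply: sub_pairwise => x y xy.
  by apply/entirely_beforeP => i j; rewrite !inE => /eqP-> /eqP->.
case sE : s memF sF nF bF => [|x t] memF sF nF bF.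
  by left; apply/fsetP => x; rewrite -memF !inE.
right; exists [fset x]%fset, [seq [fset y]%fset | y <- t]; split.
- move=> H HE; split; first exact: (allP nF).
  have /(@mapP nat {fset nat})[y yE ->] :
    H \in [seq [fset y]%fset | y <- x :: t] by [].
  right; exists y; split=> //; rewrite lt0n; apply: contraNneq F0 => <-.
  by rewrite -memF.
- by rewrite sorted_pairwise_before.
- have -> : fmin [fset x]%fset = x.
    by apply/eqP; rewrite -(in_fset1 x); apply/fmin_in/fset0Pn; exists x; rewrite inE.
  have xF : x \in F by rewrite -memF mem_head.
  by rewrite /= size_map (leq_trans _ (leq_trans cF (fmin_leq xF))) // -sF.
- apply/fsetP => y; rewrite -memF; apply/idP/bigcup_fsetP.
    move=> yE; exists [fset y]%fset; last by rewrite inE.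
    by apply/(@mapP nat {fset nat} (fun i => [fset i]%fset) (x :: t)); exists y.
  move=> [G GE]; have /(@mapP nat {fset nat})[z zE ->] :
    G \in [seq [fset z]%fset | z <- x :: t] by [].
  by rewrite inE => /eqP->.
Qed.

End SetLists.

(** A point belongs to at most one of several successive sets; the counts of pieces and cells below
    are of this kind. *)
Lemma sum_indicator_le1 (R : realType) (T : eqType) (P : pred T) (s : seq T) :
  pairwise (fun x y => ~~ (P x && P y)) s -> \sum_(x <- s) (P x)%:R <= 1 :> R.
Proof.
elim: s => [|a s IH]; first by rewrite big_nil ler01.
rewrite pairwise_cons big_cons => /andP[Pas bs].
have [Pa|Pa] := boolP (P a); last by rewrite add0r IH.
suff -> : \sum_(x <- s) (P x)%:R = 0 :> R by rewrite addr0.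
apply: big1_seq => x /andP[_ xs]; have := allP Pas x xs.
by rewrite Pa /= => /negPf->.
Qed.

Lemma sumr_const_list (R : realType) (T : Type) (s : seq T) (a : R) :
  \sum_(x <- s) a = (size s)%:R * a.
Proof. by rewrite big_const_seq count_predT iter_addr_0 mulr_natl. Qed.

(** * The limit norms on c00 *)

Section NormIter.

Variables (R : realType) (fam : nat -> seq {fset nat} -> Prop) (th : nat -> R).
Implicit Types (E : {fset nat}) (Es : seq {fset nat}) (x y : nat -> R).

Hypothesis th01 : forall k, (0 < k)%N -> 0 <= th k <= 1.
Hypothesis fam_nil : forall k, fam k [::].
Hypothesis fam_disjoint : forall k Es, fam k Es ->
  pairwise (fun E F => [disjoint E & F]%fset) Es.

Notation norm := (norm_iter fam th).
Notation vanishes_from n x := (forall i : nat, (n <= i)%N -> x i = 0).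

Lemma vanishes_from_restrict n x E :
  vanishes_from n x -> vanishes_from n (fset_restrict E x).
Proof. by move=> x0 i ni; rewrite /fset_restrict x0 ?mulr0. Qed.

Lemma sum_restrict_le n x Es :
  pairwise (fun E F => [disjoint E & F]%fset) Es ->
  \sum_(E <- Es) \sum_(i < n) `|fset_restrict E x i| <= \sum_(i < n) `|x i|.
Proof.
move=> dEs; rewrite exchange_big /=; apply: ler_sum => i _.
under eq_bigr do rewrite /fset_restrict normrM normr_nat.
rewrite -mulr_suml ler_piMl //.
apply: (@sum_indicator_le1 _ _ (fun E : {fset nat} => (i : nat) \in E)).
apply: sub_pairwise dEs => E F dEF; apply/negP => /andP[iE iF].
by have /fdisjointP/(_ _ iE) := dEF; rewrite iF.
Qed.

Lemma sup_norm_bounds n x : vanishes_from n x ->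
  (forall i, `|x i| <= sup_norm x) /\ sup_norm x <= \sum_(i < n) `|x i|.
Proof.
move=> x0; have ub : ubound [set `|x i| | i in setT] (\sum_(i < n) `|x i|).
  move=> _ [i _ <-]; have [ni|ni] := ltnP i n.
    by rewrite (bigD1 (Ordinal ni)) //= lerDl sumr_ge0.
  by rewrite x0 // normr0 sumr_ge0.
split=> [i|]; last by apply: ge_sup => //; exists `|x 0%N|; exists 0%N.
by apply: ub_le_sup; [exists (\sum_(i < n) `|x i|)|exists i].
Qed.

(** Disjointness keeps the sums over a family below the l^1 norm, and the empty family keeps the
    inner sets nonempty. Together they make the suprema in [norm_iter] genuine, since [sup] of an
    empty or unbounded set is the default 0. *)
Lemma norm_iter_bounds m n x : vanishes_from n x ->
  0 <= norm m x <= \sum_(i < n) `|x i|.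
Proof.
elim: m x => [|m IH] x x0 /=.
  have [h1 h2] := sup_norm_bounds x0; rewrite h2 andbT.
  exact: le_trans (h1 0%N).
have /andP[n0 nl] := IH _ x0; rewrite le_max n0 /= ge_max nl /=.
apply: ge_sup; first by eexists; exists 1%N.
move=> _ [k /= k0 <-]; have /andP[thk0 thk1] := th01 k0.
apply: (@le_trans _ _ (th k * \sum_(i < n) `|x i|)); last first.
  by rewrite ler_piMl // sumr_ge0.
apply: ler_wpM2l => //; apply: ge_sup; first by eexists; exists [::].
move=> _ [Es famEs <-]; apply: le_trans (sum_restrict_le n x (fam_disjoint famEs)).
by apply: ler_sum => E _; have /andP[] := IH _ (vanishes_from_restrict E x0).
Qed.

Lemma norm_iter_ge m n x k Es : vanishes_from n x -> (0 < k)%N -> fam k Es ->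
  th k * \sum_(E <- Es) norm m (fset_restrict E x) <= norm m.+1 x.
Proof.
move=> x0 k0 famEs /=; rewrite le_max; apply/orP; right.
pose S := \sum_(i < n) `|x i|.
have ubS j : ubound [set \sum_(E <- Fs) norm m (fset_restrict E x) | Fs in fam j] S.
  move=> _ [Fs famFs <-]; apply: le_trans (sum_restrict_le n x (fam_disjoint famFs)).
  apply: ler_sum => E _.
  by have /andP[] := norm_iter_bounds m (vanishes_from_restrict E x0).
have S0 : 0 <= S by rewrite sumr_ge0.
have /andP[thk0 _] := th01 k0.
apply: (@le_trans _ _ (th k *
    sup [set \sum_(E <- Fs) norm m (fset_restrict E x) | Fs in fam k])).
  apply: ler_wpM2l => //; apply: ub_le_sup; last by exists Es.
  by exists S; exact: ubS.
apply: ub_le_sup; last by exists k.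
exists S => _ [j /= j0 <-]; have /andP[thj0 thj1] := th01 j0.
apply: (@le_trans _ _ (th j * S)); last by rewrite ler_piMl.
apply: ler_wpM2l => //; apply: ge_sup; last exact: ubS.
by eexists; exists [::].
Qed.

Lemma norm_iter_nondecreasing x : {homo norm^~ x : m m' / (m <= m')%N >-> m <= m'}.
Proof. by apply: homo_leq => //= [? ? ?|m]; [exact: le_trans|rewrite le_max lexx]. Qed.

Lemma norm_iter_cvg n x : vanishes_from n x -> cvgn (norm^~ x).
Proof.
move=> x0; apply: nondecreasing_is_cvgn; first exact: norm_iter_nondecreasing.
exists (\sum_(i < n) `|x i|) => _ [m _ <-].
by have /andP[] := norm_iter_bounds m x0.
Qed.

Lemma norm_iter_le_limit m n x :
  vanishes_from n x -> norm m x <= limit_norm fam th x.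
Proof.
move=> x0; apply: (nondecreasing_cvgn_le (u_ := norm^~ x)).
  exact: norm_iter_nondecreasing.
exact: norm_iter_cvg x0.
Qed.

Lemma limit_norm_le n x r : vanishes_from n x ->
  (forall m, norm m x <= r) -> limit_norm fam th x <= r.
Proof.
move=> x0 xr; apply: limr_le; first exact: norm_iter_cvg x0.
exact: nearW.
Qed.

Lemma limit_norm_le_l1 n x : vanishes_from n x ->
  limit_norm fam th x <= \sum_(i < n) `|x i|.
Proof.
move=> x0; apply: (limit_norm_le x0) => m.
by have /andP[] := norm_iter_bounds m x0.
Qed.

Lemma normr_le_limit_norm n x i :
  vanishes_from n x -> `|x i| <= limit_norm fam th x.
Proof.
move=> x0; apply: le_trans (norm_iter_le_limit 0 x0).
by have [] := sup_norm_bounds x0.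
Qed.

(** Half of the implicit equation of the norm, got from [norm_iter_ge] as m tends to infinity; a
    family is finite, so limits pass through its sum. *)
Lemma limit_norm_ge n x k Es : vanishes_from n x -> (0 < k)%N -> fam k Es ->
  th k * \sum_(E <- Es) limit_norm fam th (fset_restrict E x)
    <= limit_norm fam th x.
Proof.
move=> x0 k0 famEs.
have cE E := norm_iter_cvg (vanishes_from_restrict E x0).
have cvS : (fun m => th k * \sum_(E <- Es) norm m (fset_restrict E x)) @ \oo -->
    th k * \sum_(E <- Es) limit_norm fam th (fset_restrict E x).
  apply: cvgMr; elim: Es {famEs} => [|E Es IH].
    rewrite big_nil; under eq_cvg do rewrite big_nil; exact: cvg_cst.
  by rewrite big_cons; under eq_cvg do rewrite big_cons; apply: cvgD => //; exact: cE.
rewrite -(cvg_lim _ cvS)//; apply: limr_le; first by apply/cvg_ex; eexists; exact: cvS.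
apply: nearW => m; apply: le_trans (norm_iter_ge m x0 k0 famEs) _.
exact: norm_iter_le_limit x0.
Qed.

(** The other half: on the members of a family the iterates are dominated by the limit norm, which
    closes the induction on the iterates of x. *)
Lemma limit_norm_le_of_families n x r : vanishes_from n x ->
  (forall i, `|x i| <= r) ->
  (forall k Es, (0 < k)%N -> fam k Es ->
    th k * \sum_(E <- Es) limit_norm fam th (fset_restrict E x) <= r) ->
  limit_norm fam th x <= r.
Proof.
move=> x0 xr famr; apply: (limit_norm_le x0); elim=> [|m IH] /=.
  by apply: ge_sup => [|_ [i _ <-]//]; exists `|x 0%N|; exists 0%N.
rewrite ge_max IH /=; apply: ge_sup; first by eexists; exists 1%N.
move=> _ [k /= k0 <-]; have /andP[thk0 _] := th01 k0.
have r0 : 0 <= r by exact: le_trans (xr 0%N).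
have [thk|thk] := eqVneq (th k) 0; first by rewrite thk mul0r.
have thkp : 0 < th k by rewrite lt_def thk.
rewrite -ler_pdivlMl //; apply: ge_sup; first by eexists; exists [::].
move=> _ [Es famEs <-]; rewrite ler_pdivlMl //; apply: le_trans (famr _ _ k0 famEs).
apply: ler_wpM2l => //; apply: ler_sum => E _.
exact: norm_iter_le_limit (vanishes_from_restrict E x0).
Qed.

End NormIter.

(** * Vectors of c00, their restrictions and the unit vectors *)

Section C00.

Variable R : realType.
Implicit Types (x y : c00 R) (E F : {fset nat}).

Lemma c00_ext x y : (forall n, x n = y n) -> x = y.
Proof. by move=> xy; apply: val_inj; apply/funext. Qed.

Lemma c00_at0 x : x 0%N = 0.
Proof. by have /finsupp_predP[] := c00_seqP x. Qed.

Lemma c00_bounded x : exists n, forall i, (n <= i)%N -> x i = 0.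
Proof.
have /finsupp_predP[_ /finite_seqP[s sE]] := c00_seqP x.
exists (\max_(i <- s) i).+1 => i; apply: contraTeq => xi; rewrite -ltnNge ltnS.
have : [set` s] i by rewrite -sE.
by move=> /= si; apply: (@leq_bigmax_seq _ _ xpredT id).
Qed.

Lemma c00D x y n : (x + y) n = x n + y n. Proof. by []. Qed.
Lemma c00N x n : (- x) n = - x n. Proof. by []. Qed.
Lemma c00Z a x n : (a *: x) n = a * x n. Proof. by []. Qed.
Lemma c00_0 n : (0 : c00 R) n = 0. Proof. by []. Qed.

Lemma c00_sum (I : Type) (s : seq I) (f : I -> c00 R) n :
  (\sum_(i <- s) f i) n = \sum_(i <- s) f i n.
Proof. by elim/big_rec2: _ => // i a b _ <-; rewrite c00D. Qed.

Fact restrict_subproof E x : fset_restrict E x \in @finsupp_pred R.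
Proof.
apply/finsupp_predP; split; first by rewrite /fset_restrict c00_at0 mulr0.
have /finsupp_predP[_] := c00_seqP x; apply: sub_finite_set => n /=.
by rewrite /fset_restrict mulf_eq0 => /norP[].
Qed.

Definition c00_restrict E x : c00 R := C00 (restrict_subproof E x).

Lemma c00_restrictE E x n : c00_restrict E x n = (n \in E)%:R * x n.
Proof. by []. Qed.

Lemma c00_restrictI E F x :
  c00_restrict E (c00_restrict F x) = c00_restrict (E `&` F)%fset x.
Proof.
by apply: c00_ext => n; rewrite !c00_restrictE in_fsetI mulrA -natrM mulnb.
Qed.

Lemma c00_restrictD E x y :
  c00_restrict E (x + y) = c00_restrict E x + c00_restrict E y.
Proof. by apply: c00_ext => n; rewrite c00D !c00_restrictE c00D mulrDr. Qed.

Lemma c00_restrictZ E a x : c00_restrict E (a *: x) = a *: c00_restrict E x.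
Proof. by apply: c00_ext => n; rewrite c00Z !c00_restrictE c00Z mulrCA. Qed.

Lemma c00_restrict_sum (I : Type) (s : seq I) (f : I -> c00 R) E :
  c00_restrict E (\sum_(i <- s) f i) = \sum_(i <- s) c00_restrict E (f i).
Proof.
apply: c00_ext => n; rewrite c00_sum c00_restrictE c00_sum mulr_sumr.
exact: eq_bigr.
Qed.

Lemma c00_restrict_eq0 E x : (forall n, n \in E -> x n = 0) -> c00_restrict E x = 0.
Proof.
move=> xE; apply: c00_ext => n; rewrite c00_restrictE c00_0.
by have [/xE->|_] := boolP (n \in E); rewrite ?mulr0 ?mul0r.
Qed.

Fact unit_subproof (j : nat) : (fun n => (n == j.+1)%:R : R) \in @finsupp_pred R.
Proof.
apply/finsupp_predP; split=> //.
apply: (@sub_finite_set _ _ [set j.+1]); last exact: finite_set1.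
by move=> n /=; have [->|] := eqVneq n j.+1; rewrite ?eqxx.
Qed.

(* The basis vector e_(j+1). *)
Definition c00_unit j : c00 R := C00 (unit_subproof j).

Lemma c00_unitE j n : c00_unit j n = (n == j.+1)%:R. Proof. by []. Qed.

End C00.

(** Pigeonhole: the first s coordinates, rounded to a grid of step eps, take finitely many values,
    so two indices from n0 on agree after rounding. *)
Lemma close_pair (R : realType) (w : nat -> nat -> R) (C eps : R) (n0 s : nat) :
  0 < eps -> (forall j i, `|w j i| <= C) ->
  exists j j', (n0 <= j < j')%N /\
    forall i, (i < s)%N -> `|w j i - w j' i| <= eps.
Proof.
move=> eps0 wC.
have wCp j i : 0 <= (w j i + C) / eps.
  rewrite divr_ge0 ?(ltW eps0) // -lerBlDr sub0r.
  by have := wC j i; rewrite ler_norml => /andP[].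
pose q j i := Num.truncn ((w j i + C) / eps).
pose Q := Num.truncn ((C + C) / eps).
have qQ j i : (q j i < Q.+1)%N.
  rewrite ltnS; apply: le_truncn; rewrite ler_pM2r ?invr_gt0 // lerD2r.
  by have := wC j i; rewrite ler_norml => /andP[].
have qclose j j' i : q j i = q j' i -> `|w j i - w j' i| <= eps.
  move=> qq; have /andP[a1 a2] := truncn_itv (wCp j i).
  have /andP[b1 b2] := truncn_itv (wCp j' i).
  move: a1 a2 b1 b2; rewrite -/(q j i) -/(q j' i) qq -natr1.
  rewrite !ler_pdivlMr // !ltr_pdivrMr // => a1 a2 b1 b2.
  by rewrite ler_norml; apply/andP; split; lra.
pose g (k : 'I_#|{ffun 'I_s -> 'I_Q.+1}|.+1) : {ffun 'I_s -> 'I_Q.+1} :=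
  [ffun i : 'I_s => inord (q (n0 + k)%N i)].
have [/leq_card|] := pselect (injective g); first by rewrite card_ord ltnn.
move=> /existsNP[k /existsNP[k' /not_implyP[gkk' kk']]].
have {gkk'} qkk' i : (i < s)%N -> q (n0 + k)%N i = q (n0 + k')%N i.
  move=> si; have /(congr1 val) := congr1 (fun h : {ffun _ -> _} => h (Ordinal si)) gkk'.
  by rewrite !ffunE /= !inordK ?qQ.
have [ltkk'|ltk'k|/val_inj//] := ltngtP k k'.
  exists (n0 + k)%N, (n0 + k')%N; split=> [|i /qkk'/qclose//].
  by rewrite leq_addr ltn_add2l.
exists (n0 + k')%N, (n0 + k)%N; split=> [|i /qkk'/qclose].
  by rewrite leq_addr ltn_add2l.
by rewrite distrC.
Qed.

(** * Upper estimates for the Tsirelson norm *)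

Section Construction.

Variables (R : realType) (theta : nat -> R) (Theta d : R).
Hypothesis theta01 : forall k, (0 < k)%N -> 0 <= theta k <= 1.
Hypothesis theta_le : forall k, (0 < k)%N -> theta k <= d * Theta ^+ k.
Hypothesis Theta_gt0 : 0 < Theta.
Hypothesis d_ge0 : 0 <= d.

Local Notation N := (tsirelson_norm theta).
Hypothesis normD : forall x y, N (x + y) <= N x + N y.
Hypothesis normZ : forall a x, N (a *: x) = `|a| * N x.

Implicit Types (E F : {fset nat}) (Es : seq {fset nat}) (v : c00 R).

Let ThetaX_ge0 m : 0 <= Theta ^+ m. Proof. by rewrite exprn_ge0 ?ltW. Qed.

Lemma admissible_nil k : admissible k [::].
Proof.
split=> //; have -> : min_set [::] = fset0 by apply/fsetP => x; rewrite !inE.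
by case: k => [|k]; left.
Qed.

Lemma admissible_disjoint k Es : admissible k Es ->
  pairwise (fun E F => [disjoint E & F]%fset) Es.
Proof.
move=> /admissible_weakly[_]; apply: sub_pairwise => E F /entirely_beforeP EF.
by apply/fdisjointP => x xE; apply/negP => xF; have := EF _ _ xE xF; rewrite ltnn.
Qed.

Lemma coord_le_norm (x : c00 R) n : `|x n| <= N x.
Proof.
have [s x0] := c00_bounded x.
exact: (normr_le_limit_norm theta01 admissible_nil admissible_disjoint n x0).
Qed.

Lemma norm_ge0 (x : c00 R) : 0 <= N x.
Proof. exact: le_trans (coord_le_norm x 0%N). Qed.

Lemma norm0 : N 0 = 0.
Proof. by rewrite -(scale0r 0) normZ normr0 mul0r. Qed.

Lemma norm_sum (I : Type) (s : seq I) (f : I -> c00 R) :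
  N (\sum_(i <- s) f i) <= \sum_(i <- s) N (f i).
Proof.
elim/big_rec2: _ => [|i a b _ ab]; first by rewrite norm0.
by apply: le_trans (normD _ _) _; rewrite lerD2l.
Qed.

Lemma norm_unit j : N (c00_unit R j) <= 1.
Proof.
have u0 i : (j.+2 <= i)%N -> c00_unit R j i = 0.
  by move=> ji; rewrite c00_unitE gtn_eqF.
apply: le_trans
  (limit_norm_le_l1 theta01 admissible_nil admissible_disjoint u0) _.
rewrite big_ord_recr /= eqxx normr1 big1 ?add0r // => i _.
by rewrite ltn_eqF // normr0.
Qed.

Lemma norm_le_of_families (x : c00 R) r : (forall n, `|x n| <= r) ->
  (forall k Es, (0 < k)%N -> weakly_admissible k Es ->
    pairwise entirely_before Es ->
    theta k * \sum_(E <- Es) N (c00_restrict E x) <= r) -> N x <= r.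
Proof.
move=> xr famr; have [s x0] := c00_bounded x.
apply: (limit_norm_le_of_families theta01 admissible_nil admissible_disjoint x0 xr).
by move=> k Es k0 /admissible_weakly[aEs bEs]; exact: famr.
Qed.

(* The sum on the left is what a norming functional can get from v in the middle *)
(* of a node of depth m, when v has first been cut into at most n0 pieces; the   *)
(* pieces all stop at the same depth m.                                          *)
Definition split_bound (n0 : nat) (b : nat -> R) v : Prop :=
  forall m (Ess : seq (seq {fset nat})), (size Ess <= n0)%N ->
    (forall Es, Es \in Ess -> weakly_admissible m Es) ->
    pairwise entirely_before (flatten Ess) ->
    Theta ^+ m * \sum_(E <- flatten Ess) N (c00_restrict E v) <= b m.

Lemma split_bound_ge0 n0 b v m : split_bound n0 b v -> 0 <= b m.
Proof.
by move=> /(_ m [::]); rewrite big_nil mulr0; apply.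
Qed.

Lemma split_bound_le n0 b b' v : (forall m, b m <= b' m) ->
  split_bound n0 b v -> split_bound n0 b' v.
Proof. by move=> bb' bv m Ess h1 h2 h3; exact: le_trans (bv m Ess h1 h2 h3) _. Qed.

Lemma split_bound_widen n0 n1 b v : (n0 <= n1)%N ->
  split_bound n1 b v -> split_bound n0 b v.
Proof. by move=> n01 bv m Ess szE; apply: bv; exact: leq_trans n01. Qed.

Lemma split_bound0 n0 : split_bound n0 (fun=> 0) 0.
Proof.
move=> m Ess _ _ _; rewrite big1 ?mulr0 // => E _.
by rewrite c00_restrict_eq0 ?norm0.
Qed.

Lemma split_boundD n0 b b' v v' : split_bound n0 b v -> split_bound n0 b' v' ->
  split_bound n0 (fun m => b m + b' m) (v + v').
Proof.
move=> bv bv' m Ess h1 h2 h3.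
apply: le_trans (lerD (bv m Ess h1 h2 h3) (bv' m Ess h1 h2 h3)).
rewrite -mulrDr ler_wpM2l ?ThetaX_ge0 // -big_split /=; apply: ler_sum => E _.
by rewrite c00_restrictD normD.
Qed.

Lemma split_boundN n0 b v : split_bound n0 b v -> split_bound n0 b (- v).
Proof.
move=> bv m Ess h1 h2 h3; apply: le_trans (bv m Ess h1 h2 h3).
rewrite ler_wpM2l ?ThetaX_ge0 //; apply: ler_sum => E _.
by rewrite -scaleN1r c00_restrictZ normZ normrN1 mul1r.
Qed.

(** Of several successive sets only one can contain [j.+1]. *)
Lemma split_bound_unit n0 j : split_bound n0 (fun m => Theta ^+ m) (c00_unit R j).
Proof.
move=> m Ess _ _ bEs; rewrite ler_piMr ?ThetaX_ge0 //.
apply: (@le_trans _ _ (\sum_(E <- flatten Ess) (j.+1 \in E)%:R)).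
  apply: ler_sum => E _; have [jE|jE] := boolP (j.+1 \in E).
    suff -> : c00_restrict E (c00_unit R j) = c00_unit R j by exact: norm_unit.
    apply: c00_ext => n; rewrite c00_restrictE c00_unitE.
    by have [->|] := eqVneq n j.+1; rewrite ?jE ?mulr1 ?mulr0.
  rewrite c00_restrict_eq0 ?norm0 // => n nE; rewrite c00_unitE.
  by case: eqP nE jE => // -> ->.
apply: sum_indicator_le1; apply: sub_pairwise bEs => E F /entirely_beforeP EF.
by apply/negP => /andP[jE jF]; have := EF _ _ jE jF; rewrite ltnn.
Qed.

(** * Long averages of far apart vectors *)

Section Average.

Variables (nn : nat -> nat) (vs : nat -> c00 R) (M : nat) (b : nat -> R) (B : R).
Hypothesis nn0 : (0 < nn 0)%N.
Hypothesis nn_le : forall i, (nn i <= nn i.+1)%N.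
Hypothesis vs_supp : forall i n, vs i n != 0 -> (nn i < n <= nn i.+1)%N.
Hypothesis vs_bound : forall i, split_bound (nn i) b (vs i).
Hypothesis b_le : forall m, b m <= B.
Hypothesis M_gt0 : (0 < M)%N.

Let v := (Theta * M%:R)^-1 *: \sum_(0 <= i < M) vs i.

Let cell i n := (nn i < n <= nn i.+1)%N.

Let nn_mono i j : (i <= j)%N -> (nn i <= nn j)%N.
Proof. by apply: (@homo_leq _ _ leq) => //; exact: leq_trans. Qed.

Let nn_gt0 i : (0 < nn i)%N.
Proof. exact: leq_trans nn0 (nn_mono (leq0n i)). Qed.

Let Mr_gt0 : 0 < M%:R :> R. Proof. by rewrite ltr0n. Qed.

Let Mr_inv_ge0 : 0 <= M%:R^-1 :> R. Proof. by rewrite invr_ge0 ltW. Qed.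

Let ThetaM_inv_ge0 : 0 <= (Theta * M%:R)^-1.
Proof. by rewrite invr_ge0 mulr_ge0 // ltW. Qed.

Let b_ge0 m : 0 <= b m. Proof. exact: (split_bound_ge0 m (@vs_bound 0%N)). Qed.

Let B_ge0 : 0 <= B. Proof. exact: le_trans (b_ge0 0%N) (b_le 0%N). Qed.

Let cells_disjoint i j n : cell i n -> cell j n -> i = j.
Proof.
move=> /andP[i1 i2] /andP[j1 j2]; have [ij|ij|//] := ltngtP i j.
  by have := leq_trans j1 (leq_trans i2 (nn_mono ij)); rewrite ltnn.
by have := leq_trans i1 (leq_trans j2 (nn_mono ij)); rewrite ltnn.
Qed.

(** A family with union F meets the cell i in one of two ways. If it reaches back to [nn i]
    ([inner]), an S_1 grouping of it has at most [nn i] groups; otherwise it starts after [nn i],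
    and i is the first cell that it meets ([first_cell]). *)
Let inner F i := has (fun n => n <= nn i)%N F && has (cell i) F.

Let first_cell F i := all (fun n => nn i < n)%N F && has (cell i) F.

Let first_cell_uniq F : \sum_(0 <= i < M) (first_cell F i)%:R <= 1 :> R.
Proof.
apply: sum_indicator_le1; apply/(pairwiseP 0%N) => i j.
rewrite !inE size_iota subn0 => iM jM ij; rewrite !nth_iota ?subn0 // !add0n.
apply/negP => /andP[/andP[_ /hasP[x xF /andP[_ xi]]] /andP[/allP/(_ _ xF)]].
move=> /leq_trans/(_ xi) h _; have := leq_trans h (nn_mono ij).
by rewrite ltnn.
Qed.

Let restrict_cell_eq0 E i : ~~ has (cell i) E -> c00_restrict E (vs i) = 0.
Proof.
move=> /hasPn nE; apply: c00_restrict_eq0 => n nEn; apply: contraNeq (nE _ nEn).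
exact: vs_supp.
Qed.

(** An inner cell is charged [b m], through the grouping into at most [nn i] families of depth m. A
    first cell is charged at depth [m.+1] by the uniform bound B, and the missing factor Theta turns
    it into [B / Theta]. *)
Let family_cell_le m Es F i : weakly_admissible m.+1 Es ->
  pairwise entirely_before Es -> (forall E, E \in Es -> {subset E <= F}) ->
  Theta ^+ m * \sum_(E <- Es) N (c00_restrict E (vs i)) <=
    b m * (inner F i)%:R + B / Theta * (first_cell (\bigcup_(E <- Es) E)%fset i)%:R.
Proof.
move=> aEs bEs EsF; set U := (\bigcup_(E <- Es) E)%fset.
have UP x : reflect (exists2 E, E \in Es & x \in E) (x \in U) by exact: bigcup_fsetP.
have Th0 := ltW Theta_gt0.
have r1 : 0 <= b m * (inner F i)%:R by rewrite mulr_ge0.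
have r2 : 0 <= B / Theta * (first_cell U i)%:R by rewrite mulr_ge0 // divr_ge0.
have [cU|ncU] := boolP (has (cell i) U); last first.
  rewrite big1_seq ?mulr0 ?addr_ge0 // => E /andP[_ EEs].
  rewrite restrict_cell_eq0 ?norm0 //; apply: contra ncU => /hasP[x xE xi].
  by apply/hasP; exists x => //; apply/UP; exists E.
have [aU|/allPn[x /UP[E EEs xE] xi]] := boolP (all (fun n => nn i < n)%N U).
  apply: (@le_trans _ _ (B / Theta)); last by rewrite /first_cell cU aU mulr1 lerDr.
  rewrite ler_pdivlMr // mulrAC -exprSr.
  have := @vs_bound i m.+1 [:: Es]; rewrite /= cats0 => h.
  apply: le_trans (h _ _ bEs) (b_le _) => // Gs; by rewrite inE => /eqP->.
rewrite -leqNgt in xi.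
have -> : inner F i.
  apply/andP; split; first by apply/hasP; exists x => //; exact: EsF EEs _ xE.
  have /hasP[y /UP[G GEs yG] yi] := cU.
  by apply/hasP; exists y => //; exact: EsF GEs _ yG.
rewrite mulr1; apply: ler_wpDr => //.
case: aEs => Gss [EsE szG admG]; rewrite EsE; apply: vs_bound => //.
  exact: leq_trans (szG _ _ EEs xE) xi.
by rewrite -EsE.
Qed.

(** A family has at most one first cell, so this charge is divided by the length M of the average
    and becomes an error term. *)
Let family_le m Es F : weakly_admissible m.+1 Es ->
  pairwise entirely_before Es -> (forall E, E \in Es -> {subset E <= F}) ->
  Theta ^+ m.+1 * \sum_(E <- Es) N (c00_restrict E v) <=
    b m / M%:R * \sum_(0 <= i < M) (inner F i)%:R + B / (Theta * M%:R).
Proof.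
move=> aEs bEs EsF.
apply: (@le_trans _ _ (M%:R^-1 * \sum_(0 <= i < M)
    (Theta ^+ m * \sum_(E <- Es) N (c00_restrict E (vs i))))).
  rewrite -mulr_sumr exchange_big /= exprSr -mulrA [leRHS]mulrCA.
  rewrite ler_wpM2l // mulr_sumr [leRHS]mulr_sumr.
  apply: ler_sum => E _; rewrite c00_restrictZ c00_restrict_sum normZ.
  rewrite ger0_norm // invfM mulrA mulVKf ?gt_eqF //.
  by rewrite ler_wpM2l // norm_sum.
apply: (@le_trans _ _ (M%:R^-1 * \sum_(0 <= i < M) (b m * (inner F i)%:R +
    B / Theta * (first_cell (\bigcup_(E <- Es) E)%fset i)%:R))).
  rewrite ler_wpM2l //; apply: ler_sum => i _.
  exact: family_cell_le.
rewrite big_split /= -!mulr_sumr mulrDr; apply: lerD.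
  by rewrite mulrA [_ / _]mulrC.
have -> a : M%:R^-1 * (B / Theta * a) = B / (Theta * M%:R) * a.
  by rewrite invfM; ring.
by rewrite ler_piMr ?first_cell_uniq // divr_ge0 // mulr_ge0 // ltW.
Qed.

Let inner_uniq (Fs : seq {fset nat}) i :
  pairwise entirely_before Fs -> \sum_(F <- Fs) (inner F i)%:R <= 1 :> R.
Proof.
move=> bF; apply: sum_indicator_le1; apply: sub_pairwise bF => E F.
move=> /entirely_beforeP EF; apply/negP => /andP[/andP[_ /hasP[y yE]]].
move=> /andP[iy _] /andP[/hasP[x xF xi] _].
by have := ltn_trans (EF _ _ yE xF) (leq_ltn_trans xi iy); rewrite ltnn.
Qed.

Let sum_inner_le (Fs : seq {fset nat}) : pairwise entirely_before Fs ->
  \sum_(F <- Fs) \sum_(0 <= i < M) (inner F i)%:R <= M%:R :> R.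
Proof.
move=> bF; rewrite exchange_big /=.
apply: (@le_trans _ _ (\sum_(0 <= i < M) (1 : R))).
  by apply: ler_sum => i _; exact: inner_uniq.
by rewrite sumr_const_nat subn0.
Qed.

Let coord_average_le n : `|v n| <= B / (Theta * M%:R).
Proof.
rewrite c00Z normrM ger0_norm // [leRHS]mulrC ler_wpM2l // c00_sum.
apply: le_trans (ler_norm_sum _ _ _) _.
apply: (@le_trans _ _ (\sum_(0 <= i < M) B * (cell i n)%:R)).
  apply: ler_sum => i _; have [->|vn] := eqVneq (vs i n) 0.
    by rewrite normr0 mulr_ge0.
  rewrite /cell vs_supp // mulr1.
  (* The singleton of n is a single family of depth 0, allowed because [nn i] is positive. *)
  apply: le_trans (le_trans _ (@vs_bound i 0%N [:: [:: [fset n]%fset]] _ _ _)) (b_le 0%N).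
  - rewrite expr0 mul1r /= big_seq1.
    by apply: le_trans (coord_le_norm _ n); rewrite c00_restrictE inE eqxx mul1r.
  - exact: nn_gt0.
  - by move=> Es; rewrite inE => /eqP->.
  - by [].
rewrite -mulr_sumr ler_piMr //; apply: sum_indicator_le1; apply/(pairwiseP 0%N) => i j.
rewrite !inE size_iota subn0 => iM jM ij; rewrite !nth_iota ?subn0 // !add0n.
by apply/negP => /andP[/cells_disjoint h /h]; apply/eqP; rewrite ltn_eqF.
Qed.

(** The top node pays theta_k <= d Theta^k, and this d multiplies the charge of the inner cells.
    Coordinates and the first cell only give an error of order 1 / M. *)
Lemma norm_piece_le F :
  N (c00_restrict F v) <= d * (B / M%:R * \sum_(0 <= i < M) (inner F i)%:R)
    + (d + 1) * (B / (Theta * M%:R)).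
Proof.
have q0 : 0 <= B / (Theta * M%:R) by rewrite divr_ge0 // mulr_ge0 ?ltW.
have s0 : 0 <= \sum_(0 <= i < M) (inner F i)%:R :> R.
  by apply: sumr_ge0 => i _; exact: ler0n.
have p0 : 0 <= B / M%:R by rewrite divr_ge0 // ltW.
apply: norm_le_of_families => [n|[//|k] Es _ aEs bEs].
  rewrite c00_restrictE normrM; apply: (@le_trans _ _ (B / (Theta * M%:R))).
    apply: le_trans (coord_average_le n).
    by rewrite ler_piMl // normr_nat; case: (_ \in _).
  by rewrite mulrDl mul1r addrA lerDr addr_ge0 // mulr_ge0 // mulr_ge0.
under eq_bigr do rewrite c00_restrictI.
have S0 : 0 <= \sum_(E <- Es) N (c00_restrict (E `&` F)%fset v).
  by apply: sumr_ge0 => E _; exact: norm_ge0.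
apply: (le_trans (ler_wpM2r S0 (theta_le (ltn0Sn k)))); rewrite -[leLHS]mulrA.
have := family_le (F := F) (weakly_admissible_fsetI F aEs)
  (pairwise_before_fsetI F bEs).
rewrite big_map => h.
apply: le_trans (ler_wpM2l d_ge0 (h _)) _.
  by move=> _ /mapP[E _ ->] x /fsetIP[].
rewrite mulrDr mulrDl mul1r addrA ler_wpDr // lerD2r ler_wpM2l // ler_wpM2r //.
by rewrite ler_wpM2r.
Qed.

(** At depth 0 each piece must open a node of its own and pays d; at depth [m'.+1] one level is
    spent on reaching the terms of the average, which leaves depth [m']. A cell is inner to at most
    one piece, so the inner charges add up to at most [d * B] or [b m'], and eps holds the errors of
    the n0 pieces. *)
Lemma split_bound_average n0 eps :
  n0%:R * ((d + 1) * (B / (Theta * M%:R))) <= eps ->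
  split_bound n0 (fun m => if m is m'.+1 then b m' + eps else d * B + eps) v.
Proof.
move=> heps.
have q0 : 0 <= B / (Theta * M%:R) by rewrite divr_ge0 // mulr_ge0 ?ltW.
have p0 : 0 <= B / M%:R by rewrite divr_ge0 // ltW.
move=> [|m] Ess szE aE bE.
  rewrite expr0 mul1r.
  apply: le_trans (ler_sum _ (fun E _ => norm_piece_le E)) _.
  rewrite big_split /=; apply: lerD.
    rewrite -!mulr_sumr ler_wpM2l // mulrAC ler_pdivrMr // ler_wpM2l //.
    exact: sum_inner_le.
  apply: le_trans heps; rewrite sumr_const_list ler_wpM2r //.
    by rewrite mulr_ge0 // addr_ge0.
  rewrite ler_nat; apply: leq_trans szE; elim: Ess aE {bE} => [//|Es Ess IH] aE /=.
  rewrite size_cat -add1n leq_add ?aE ?mem_head // IH // => Gs GsE.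
  by apply: aE; rewrite inE GsE orbT.
rewrite big_flatten /= mulr_sumr.
apply: (@le_trans _ _ (\sum_(Es <- Ess) (b m / M%:R *
   \sum_(0 <= i < M) (inner (\bigcup_(E <- Es) E)%fset i)%:R + B / (Theta * M%:R)))).
  rewrite big_seq [leRHS]big_seq; apply: ler_sum => Es EsE.
  apply: family_le; first exact: aE.
    elim: Ess bE EsE {szE aE} => [//|Gs Ess IH] /=.
    rewrite pairwise_cat inE => /and3P[_ bG bE] /orP[/eqP->//|]; exact: IH.
  by move=> E EEs x xE; apply/bigcup_fsetP; exists E.
rewrite big_split /=; apply: lerD.
  rewrite -mulr_sumr mulrAC ler_pdivrMr // ler_wpM2l //.
  pose U := fun Es : seq {fset nat} => (\bigcup_(E <- Es) E)%fset.
  rewrite -(big_map U xpredT (fun F => \sum_(0 <= i < M) (inner F i)%:R)).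
  apply: sum_inner_le; elim: Ess bE {szE aE} => [//|Gs Ess IH] /=.
  rewrite pairwise_cat => /and3P[GE _ /IH->]; rewrite andbT.
  apply/allP => _ /mapP[Es EsE ->]; apply/entirely_beforeP => x y.
  move=> /bigcup_fsetP[E EGs xE] /bigcup_fsetP[F FEs yF].
  have FE : F \in flatten Ess by apply/flattenP; exists Es.
  by have /allrelP/(_ _ _ EGs FE)/entirely_beforeP := GE; apply.
apply: le_trans heps; rewrite sumr_const_list.
apply: (@le_trans _ _ (n0%:R * (B / (Theta * M%:R)))).
  by rewrite ler_wpM2r // ler_nat.
by rewrite ler_wpM2l // ler_peMl // lerDr.
Qed.

End Average.

(** * Allowable families and concatenation of admissible ones *)

Lemma allowable_nil k : allowable k [::].
Proof. by have [? ? ?] := admissible_nil k. Qed.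

Lemma allowable_disjoint k Es : allowable k Es ->
  pairwise (fun E F => [disjoint E & F]%fset) Es.
Proof. by case. Qed.

Lemma admissible_allowable k Es : admissible k Es -> allowable k Es.
Proof. by move=> aEs; have := admissible_disjoint aEs; case: aEs. Qed.

Lemma modified_norm_ge k Es v : (0 < k)%N -> allowable k Es ->
  theta k * \sum_(E <- Es) modified_tsirelson_norm theta (c00_restrict E v)
    <= modified_tsirelson_norm theta v.
Proof.
move=> k0 aEs; have [s v0] := c00_bounded v.
exact: (limit_norm_ge theta01 allowable_nil allowable_disjoint v0 k0 aEs).
Qed.

(** The sets of minima of the member families are the S_h-sets that make up an S_(h+1)-set; their
    number is at most every point, hence at most the first minimum. *)
Lemma admissible_flatten h (Ess : seq (seq {fset nat})) :
  (0 < size Ess)%N ->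
  (forall Es, Es \in Ess -> admissible h Es /\ Es != [::]) ->
  pairwise entirely_before (flatten Ess) ->
  (forall E x, E \in flatten Ess -> x \in E -> (size Ess <= x)%N) ->
  admissible h.+1 (flatten Ess).
Proof.
move=> sz0 aE bE szE.
have nE : all nonempty_index_set (flatten Ess).
  apply/allP => E /flattenP[Es /aE[[/allP nEs _ _] _]]; exact: nEs.
have neq0 E : E \in flatten Ess -> E != fset0 by move=> /(allP nE)/andP[].
split=> //; first by rewrite sorted_pairwise_before.
have nm : all nonempty_index_set (map min_set Ess).
  apply/allP => _ /mapP[Es EsE ->]; have [_] := aE _ EsE.
  case: Es EsE => [//|E Es] EsE _; apply/andP; split.
    by apply/fset0Pn; exists (fmin E); apply/min_setP; exists E => //; exact: mem_head.
  apply/negP => /min_setP[F FEs F0].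
  have FE : F \in flatten Ess by apply/flattenP; exists (E :: Es).
  by have /andP[F1] := allP nE _ FE; rewrite F0 fmin_in.
have memm x Es : Es \in Ess -> x \in min_set Es ->
    exists2 E, E \in flatten Ess & x \in E.
  move=> EsE /min_setP[E EEs ->].
  have EE : E \in flatten Ess by apply/flattenP; exists Es.
  by exists E => //; exact/fmin_in/neq0.
have bm : pairwise entirely_before (map min_set Ess).
  elim: Ess bE neq0 {sz0 aE szE nE nm memm} => [//|Es Ess IH] /=.
  rewrite pairwise_cat => /and3P[EsE _ bE] neq0; rewrite IH // ?andbT; last first.
    by move=> E EE; apply: neq0; rewrite mem_cat EE orbT.
  apply/allP => _ /mapP[Fs FsE ->]; apply/entirely_beforeP => x y.
  move=> /min_setP[E EEs ->] /min_setP[F FFs ->].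
  have FE : F \in flatten Ess by apply/flattenP; exists Fs.
  have /allrelP/(_ _ _ EEs FE)/entirely_beforeP := EsE; apply.
    by apply/fmin_in/neq0; rewrite mem_cat EEs.
  by apply/fmin_in/neq0; rewrite mem_cat FE orbT.
right; case: Ess sz0 aE bE szE nE nm memm bm neq0 =>
  [//|Es Ess] _ aE bE szE nE nm memm bm neq0.
exists (min_set Es), (map min_set Ess); split.
- move=> H HE; split; first exact: (allP nm).
  move: HE; rewrite -map_cons => /(@mapP (seq {fset nat}) {fset nat})[Gs GsE ->].
  by have [[]] := aE _ GsE.
- by rewrite sorted_pairwise_before.
- rewrite /= size_map.
  have mE : fmin (min_set Es) \in min_set Es.
    by apply: fmin_in; have /andP[/andP[]] := nm.
  have [E EE] := memm _ _ (mem_head _ _) mE.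
  exact: szE.
- rewrite -map_cons; apply/fsetP => x; apply/idP/idP.
    move=> /min_setP[E /flattenP[Fs FsE EFs] ->]; apply/bigcup_fsetP.
    by exists (min_set Fs); [exact: map_f|apply/min_setP; exists E].
  move=> /bigcup_fsetP[_ /(@mapP (seq {fset nat}) {fset nat})[Fs FsE ->]].
  move=> /min_setP[E EFs ->]; apply/min_setP; exists E => //.
  by apply/flattenP; exists Fs.
Qed.

Definition fset_interval (m n : nat) : {fset nat} :=
  [fset i in iota m.+1 (n - m)]%fset.

Lemma in_fset_interval m n i : (i \in fset_interval m n) = (m < i <= n)%N.
Proof.
rewrite /fset_interval inE mem_iota; have [mn|nm] := leqP m n.
  by rewrite addSn subnKC.
rewrite (eqP (ltnW nm : (n - m == 0)%N)) addn0 !ltnS.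
apply/idP/idP => /andP[mi im]; first by have := leq_trans mi im; rewrite ltnn.
by have := leq_trans mi (leq_trans im (ltnW nm)); rewrite ltnn.
Qed.

Lemma c00_restrict_id E v : (forall n, v n != 0 -> n \in E) -> c00_restrict E v = v.
Proof.
move=> vE; apply: c00_ext => n; rewrite c00_restrictE.
by have [->|/vE->] := eqVneq (v n) 0; rewrite ?mulr0 ?mul1r.
Qed.

(** * Blocks in the modified space *)

Section SlidingHump.

Variables (XM : normedModType R) (iM T : {linear c00 R -> XM}) (C delta : R).
Local Notation NM := (modified_tsirelson_norm theta).
Hypothesis iM_norm : forall v, `|iM v| = NM v.
Hypothesis iM_dense : dense (range iM).
Hypothesis delta_gt0 : 0 < delta.
Hypothesis T_unit : forall j, `|T (c00_unit R j)| <= C.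
Hypothesis T_separated : forall j j', j != j' ->
  2 * delta <= `|T (c00_unit R j - c00_unit R j')|.

(** Among the approximants of the bounded images of the unit vectors, two almost agree up to n0.
    Removing the small head of their difference leaves a vector beyond n0, and separation keeps its
    norm above delta. *)
Lemma exists_far_block (n0 : nat) (eta : R) : 0 < eta ->
  exists (j j' : nat) (u : c00 R),
    [/\ (n0 <= j < j')%N, forall n, u n != 0 -> (n0 < n)%N, delta <= NM u
      & `|T (c00_unit R j - c00_unit R j') - iM u| <= eta].
Proof.
(* Three errors are to be covered: the two approximations and the removed head. The minimum with
   delta leaves at least 2 delta - delta for the norm of u. *)
move=> eta0; pose e := Num.min eta delta / 3.
have e0 : 0 < e by rewrite divr_gt0 // lt_min eta0.
have approx j : exists w, `|T (c00_unit R j) - iM w| < e.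
  have [||y [yB [w _ wy]]] := @iM_dense (ball (T (c00_unit R j)) e).
  - by exists (T (c00_unit R j)); exact: ballxx.
  - exact: ball_open.
  by exists w; rewrite wy; rewrite -ball_normE in yB.
have [w wP] := choice approx.
have coord (v : c00 R) i : `|v i| <= NM v.
  have [s v0] := c00_bounded v.
  exact: (normr_le_limit_norm theta01 allowable_nil allowable_disjoint i v0).
have wC j i : `|w j i| <= C + e.
  apply: le_trans (coord _ _) _; rewrite -iM_norm.
  rewrite -[iM _](subrKC (T (c00_unit R j))).
  apply: le_trans (ler_normD _ _) _; rewrite lerD // distrC; exact/ltW.
have en0 : 0 < e / n0.+1%:R by rewrite divr_gt0 // ltr0n.
have [j [j' [njj' wjj']]] := close_pair (w := w) n0 n0.+1 en0 wC.
pose h := c00_restrict (fset_interval 0 n0) (w j - w j').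
have hNM : NM h <= e.
  have h0 i : (n0.+1 <= i)%N -> h i = 0.
    move=> ni; rewrite c00_restrictE in_fset_interval [(i <= n0)%N]leqNgt ni andbF.
    exact: mul0r.
  apply: le_trans
    (limit_norm_le_l1 theta01 allowable_nil allowable_disjoint h0) _.
  apply: (@le_trans _ _ (\sum_(i < n0.+1) e / n0.+1%:R)).
    apply: ler_sum => i _; rewrite c00_restrictE normrM.
    apply: le_trans (wjj' i (ltn_ord i)); rewrite ler_piMl //.
    by rewrite normr_nat; case: (_ \in _).
  by rewrite sumr_const card_ord -[leLHS]mulr_natr divfK ?pnatr_eq0.
have Th : `|T (c00_unit R j - c00_unit R j') - iM (w j - w j' - h)|
    <= Num.min eta delta.
  rewrite (linearB T) !(linearB iM).
  have -> (a b x y z : XM) : a - b - (x - y - z) = (a - x) - (b - y) + z.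
    by rewrite opprB [z - _]addrC addrA [- (x - y)]opprD addrACA -opprD.
  have -> : Num.min eta delta = e + e + e by rewrite /e; field.
  apply: le_trans (ler_normD _ _) _; rewrite lerD ?iM_norm //.
  by apply: le_trans (ler_normB _ _) _; rewrite lerD // ltW.
exists j, j', (w j - w j' - h); split=> //.
- move=> n; apply: contraR; rewrite -leqNgt => nn0.
  rewrite c00D c00N c00_restrictE in_fset_interval nn0 andbT.
  by case: n nn0 => [|n] _; rewrite ?c00_at0 ?mulr0 ?mul1r subrr.
- have jj' : j != j' by case/andP: njj' => _; rewrite ltn_neqAle => /andP[].
  move: Th; rewrite le_min -iM_norm => /andP[_ Th].
  rewrite -(lerD2l delta) -mulr2n -mulr_natl; apply: le_trans (T_separated jj') _.
  rewrite -[T _](subrK (iM (w j - w j' - h))).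
  by apply: le_trans (ler_normD _ _) _; rewrite lerD2r.
- by move: Th; rewrite le_min => /andP[].
Qed.

End SlidingHump.

(** * The vectors with far apart norms *)

Section Transfer.

Variables (XM : normedModType R) (iM T : {linear c00 R -> XM}) (delta : R).
Local Notation NM := (modified_tsirelson_norm theta).
Hypothesis iM_norm : forall v, `|iM v| = NM v.
Hypothesis delta_gt0 : 0 < delta.
Hypothesis blocks : forall (n0 : nat) (eta : R), 0 < eta ->
  exists (j j' : nat) (u : c00 R),
  [/\ (n0 <= j < j')%N, forall n, u n != 0 -> (n0 < n)%N, delta <= NM u
    & `|T (c00_unit R j - c00_unit R j') - iM u| <= eta].

Definition supported_in (m n : nat) v := forall i, v i != 0 -> (m < i <= n)%N.

(* The parts are pairwise disjoint but intertwined, so that only an allowable    *)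
(* family can separate them; the part q is normed at depth hs_q.                 *)
Definition has_parts (hs : seq nat) (m n : nat) (V : c00 R)
    (Ess : nat -> seq {fset nat}) : Prop :=
  (forall q, (q < size hs)%N ->
    [/\ admissible (nth 0 hs q) (Ess q),
        forall E, E \in Ess q -> {subset E <= fset_interval m n}
      & delta <= Theta ^+ nth 0 hs q * \sum_(E <- Ess q) NM (c00_restrict E V)])
  /\ (forall q q' E F, (q < q' < size hs)%N -> E \in Ess q -> F \in Ess q' ->
       [disjoint E & F]%fset).

Definition good hs b (m : nat) (tau : R)
    (t : nat * (c00 R * c00 R * (nat -> seq {fset nat}))) :=
  let: (n, (v, V, Ess)) := t in
  [/\ (m <= n)%N /\ supported_in m n v, supported_in m n V, split_bound m b v,
      `|T v - iM V| <= tau & has_parts hs m n V Ess].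

(** The profile b is the same for every starting point m, while [good] allows m pieces. Hence copies
    can be placed one after another, each tolerating as many pieces as the point after which it
    starts, as [split_bound_average] requires. *)
Definition attainable hs b :=
  forall (m : nat) (tau : R), 0 < tau -> exists t, good hs b m tau t.

Lemma attainable_nil : attainable [::] (fun=> 0).
Proof.
move=> m tau tau0; exists (m, (0, 0, fun=> [::])); split.
- by split=> // i; rewrite c00_0 eqxx.
- by move=> i; rewrite c00_0 eqxx.
- exact: split_bound0.
- by rewrite (linear0 T) (linear0 iM) subr0 normr0 ltW.
- by split=> // q q' E F /andP[_ /=]; rewrite ltn0.
Qed.

Lemma NM_Z a v : NM (a *: v) = `|a| * NM v.
Proof. by rewrite -!iM_norm linearZ normrZ. Qed.

(** The new block precedes the old vector, and its interval is a part of depth 0. The two unit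
    vectors cost Theta^m each; as the supports are successive, the old parts keep their lower
    bounds. *)
Lemma attainable_add hs b : attainable hs b ->
  attainable (0%N :: hs) (fun m => 2 * Theta ^+ m + b m).
Proof.
move=> att m tau tau0; have tau20 : 0 < tau / 2 by rewrite divr_gt0.
have [j [j' [u [/andP[mj jj'] um du Tu]]]] := blocks m tau20.
have [s us] := c00_bounded u.
pose n := maxn s j'.+1.
have un : supported_in m n u.
  move=> i ui; rewrite um // leq_max; apply/orP; left; rewrite leqNgt.
  by apply: contra ui => /ltnW/us->.
have mn : (m < n)%N by rewrite leq_max ltnS (leq_trans mj (ltnW jj')) orbT.
have [[n' [[y Y] Ess]] [[nn' yn] Yn by_ TY [partsY disjY]]] := att n _ tau20.
exists (n', ((c00_unit R j - c00_unit R j') + y, u + Y,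
  fun q => if q is q'.+1 then Ess q' else [:: fset_interval m n])).
have far i : (n < i <= n')%N -> (m < i <= n')%N.
  by move=> /andP[ni ->]; rewrite andbT (ltn_trans mn).
have near_ i : (m < i <= n)%N -> (m < i <= n')%N.
  by move=> /andP[-> ni]; rewrite /= (leq_trans ni).
have suppD (a a' : c00 R) : supported_in m n a -> supported_in n n' a' ->
    supported_in m n' (a + a').
  move=> am an i; rewrite c00D; have [a0|/am/near_//] := eqVneq (a i) 0.
  by rewrite a0 add0r => /an/far.
split.
- split; first by rewrite ltnW // (leq_trans mn).
  apply: suppD => // i; rewrite c00D c00N !c00_unitE.
  have [->|] := eqVneq i j.+1.
    by move=> _; rewrite ltnS mj leq_max ltnS (ltnW jj') orbT.
  have [->|] := eqVneq i j'.+1; last by rewrite subrr eqxx.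
  by move=> _ _; rewrite ltnS (leq_trans mj (ltnW jj')) leq_max leqnn orbT.
- exact: suppD.
- apply: split_bound_le (_ : forall k, (Theta ^+ k + Theta ^+ k) + b k <= _) _.
    by move=> k; rewrite mulr_natl mulr2n.
  apply: split_boundD; last exact: split_bound_widen (ltnW mn) _.
  by apply: split_boundD; [|apply: split_boundN]; exact: split_bound_unit.
- rewrite [T _]linearD [iM _]linearD opprD addrACA.
  by apply: le_trans (ler_normD _ _) _; rewrite [leRHS]splitr lerD.
- split=> [[_|q qs]|[|q] [|q'] E F].
  + split.
    * have i0 : fset_interval m n != fset0.
        by apply/fset0Pn; exists n; rewrite in_fset_interval mn leqnn.
      have z0 : 0%N \notin fset_interval m n by rewrite in_fset_interval.
      split=> //=; first by rewrite /nonempty_index_set i0 z0.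
      right; exists (fmin (fset_interval m n)); split; last first.
        apply/fsetP => x; apply/min_setP/fset1P => [[E]|->].
          by rewrite inE => /eqP->.
        by exists (fset_interval m n); rewrite ?mem_head.
      rewrite lt0n; apply: contraNneq z0 => <-; exact: fmin_in.
    * move=> E; rewrite inE => /eqP-> x; rewrite !in_fset_interval; exact: near_.
    * rewrite expr0 mul1r big_seq1 c00_restrictD c00_restrict_id.
        rewrite [c00_restrict _ Y]c00_restrict_eq0 ?addr0 // => x.
        rewrite in_fset_interval => /andP[_ xn]; apply: contraTeq xn => /Yn/andP[].
        by rewrite ltnNge.
      by move=> x /un; rewrite in_fset_interval.
  + have [a1 a2 a3] := partsY q qs; split=> //.
      by move=> E EE x /(a2 _ EE); rewrite !in_fset_interval; exact: far.
    apply: le_trans a3 _; rewrite ler_wpM2l // big_seq [leRHS]big_seq.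
    apply: ler_sum => E EE.
    rewrite c00_restrictD [c00_restrict _ u]c00_restrict_eq0 ?add0r //.
    move=> x /(a2 _ EE); rewrite in_fset_interval => /andP[nx _].
    by apply: contraTeq nx => /un/andP[_]; rewrite ltnNge negbK.
  + by [].
  + move=> q's; rewrite inE => /eqP-> FE; have [_ a2 _] := partsY q' q's.
    apply/fdisjointP => x; rewrite in_fset_interval => /andP[_ xn].
    apply/negP => /(a2 _ FE); rewrite in_fset_interval => /andP[].
    by rewrite ltnNge xn.
  + by [].
  + exact: disjY.
Qed.

(** The copies start beyond m and M, so that the families of one part in the M copies concatenate to
    an admissible family one level deeper. The factor Theta of the new level cancels the one in the
    normalization, and the part keeps its lower bound delta. *)
Lemma attainable_average hs b B eps : attainable hs b -> (forall m, b m <= B) ->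
  0 < eps ->
  attainable (map S hs) (fun m => if m is m'.+1 then b m' + eps else d * B + eps).
Proof.
move=> att bB eps0 m tau tau0.
(* The M errors [Theta * tau], scaled by (Theta M)^-1, add up to tau. *)
have ttau0 : 0 < Theta * tau by rewrite mulr_gt0.
have B0 : 0 <= B.
  have [[n [[v V] Ess]] [_ _ bv _ _]] := att m _ ttau0.
  exact: le_trans (split_bound_ge0 0 bv) (bB 0%N).
pose M := (Num.truncn (m%:R * (d + 1) * B / (Theta * eps))).+1.
have M0 : 0 < M%:R :> R by rewrite ltr0n.
have Mle : m%:R * ((d + 1) * (B / (Theta * M%:R))) <= eps.
  have : m%:R * (d + 1) * B / (Theta * eps) <= M%:R by apply/ltW/truncnS_gt.
  rewrite ler_pdivrMr ?mulr_gt0 // => h.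
  rewrite !mulrA ler_pdivrMr ?mulr_gt0 //; apply: le_trans h _.
  by rewrite le_eqVlt; apply/orP; left; apply/eqP; ring.
have M_gt0 : (0 < M)%N by [].
clearbody M; have [f fP] := choice (fun n => att n _ ttau0).
pose nn i := iter i (fun n => (f n).1) (maxn m M).
pose vs i := (f (nn i)).2.1.1.
pose Vs i := (f (nn i)).2.1.2.
pose Es i := (f (nn i)).2.2.
have gd i : good hs b (nn i) (Theta * tau) (nn i.+1, (vs i, Vs i, Es i)).
  by have := fP (nn i); rewrite /vs /Vs /Es /nn /=; case: (f _) => n [[]].
have nn0 : nn 0%N = maxn m M by [].
clearbody nn vs Vs Es.
have nnS i : (nn i <= nn i.+1)%N by have [[]] := gd i.
have nn_mono i k : (i <= k)%N -> (nn i <= nn k)%N.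
  by apply: (@homo_leq _ _ leq) => //; exact: leq_trans.
have m_nn i : (m <= nn i)%N.
  by apply: leq_trans (nn_mono _ _ (leq0n i)); rewrite nn0 leq_maxl.
have M_nn i : (M <= nn i)%N.
  by apply: leq_trans (nn_mono _ _ (leq0n i)); rewrite nn0 leq_maxr.
have avg_supp (ws : nat -> c00 R) :
    (forall i, supported_in (nn i) (nn i.+1) (ws i)) ->
    supported_in m (nn M) ((Theta * M%:R)^-1 *: \sum_(0 <= i < M) ws i).
  move=> wsP x; rewrite c00Z c00_sum => sx.
  have [/hasP[i]|/hasPn n0] := boolP (has (fun i => ws i x != 0) (index_iota 0 M)).
    rewrite mem_index_iota /= => ltiM /wsP/andP[ix xi].
    by rewrite (leq_ltn_trans (m_nn i) ix) (leq_trans xi) ?nn_mono.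
  by move: sx; rewrite big1_seq ?mulr0 ?eqxx // => i /andP[_ /n0/negPn/eqP].
exists (nn M, ((Theta * M%:R)^-1 *: \sum_(0 <= i < M) vs i,
  (Theta * M%:R)^-1 *: \sum_(0 <= i < M) Vs i,
  fun q => flatten [seq Es i q | i <- index_iota 0 M])).
have parts i := let: And5 _ _ _ _ (conj p _) := gd i in p.
split.
- by split; [exact: m_nn|apply: avg_supp => i; have [[]] := gd i].
- by apply: avg_supp => i; have [] := gd i.
- apply: (@split_bound_average nn vs M b B) => //.
  + exact: leq_trans (M_nn 0%N).
  + by move=> i x; have [[_ h] _ _ _ _] := gd i; exact: h.
  + by move=> i; have [] := gd i.
- rewrite (linearZZ T) (linearZZ iM) -scalerBr (linear_sum T) (linear_sum iM).
  rewrite -sumrB normrZ.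
  rewrite ger0_norm; last by rewrite invr_ge0 mulr_ge0 // ltW.
  rewrite ler_pdivrMl ?mulr_gt0 //.
  apply: le_trans (ler_norm_sum _ _ _) _.
  apply: (@le_trans _ _ (\sum_(0 <= i < M) Theta * tau)).
    by apply: ler_sum => i _; have [] := gd i.
  by rewrite sumr_const_nat subn0 -[leLHS]mulr_natr mulrAC.
- have inEs i q E x : (q < size hs)%N -> E \in Es i q -> x \in E ->
      (nn i < x <= nn i.+1)%N.
    move=> qs EE xE; have [_ h _] := parts i q qs.
    by have := h _ EE _ xE; rewrite in_fset_interval.
  split.
    rewrite size_map => q qs; rewrite (nth_map 0%N) //.
    (* An empty family would give 0, below the positive lower bound delta. *)
    have Es_neq0 i : Es i q != [::].
      have [_ _] := parts i q qs; apply: contraTneq => ->.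
      by rewrite big_nil mulr0 -ltNge.
    split.
    + apply: admissible_flatten.
      * by rewrite size_map size_iota subn0.
      * by move=> _ /mapP[i _ ->]; split; [have [] := parts i q qs|exact: Es_neq0].
      * rewrite /index_iota subn0; move: {1}0%N => k.
        elim: {1}M k => [//|l IH] k /=; rewrite pairwise_cat IH andbT; apply/andP; split.
          apply/allrelP => E F EE /flattenP[Gs /mapP[i]].
          rewrite mem_iota => /andP[ki _] -> FE; apply/entirely_beforeP => x y xE yF.
          have /andP[_ xk] := inEs _ _ _ _ qs EE xE.
          have /andP[iy _] := inEs _ _ _ _ qs FE yF.
          exact: leq_ltn_trans xk (leq_ltn_trans (nn_mono _ _ ki) iy).
        by have [/admissible_weakly[]] := parts k q qs.
      * move=> E x /flattenP[_ /mapP[i _ ->] EE] xE; rewrite size_map size_iota subn0.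
        have /andP[ix _] := inEs _ _ _ _ qs EE xE.
        exact: leq_trans (M_nn i) (ltnW ix).
    + move=> E /flattenP[Gs /mapP[i]]; rewrite mem_index_iota => ltiM -> EE x xE.
      have /andP[ix xi] := inEs _ _ _ _ qs EE xE.
      by rewrite in_fset_interval (leq_ltn_trans (m_nn i) ix) (leq_trans xi) ?nn_mono.
    + rewrite big_flatten /= big_map.
      have -> : \sum_(0 <= i < M) \sum_(E <- Es i q) NM (c00_restrict E
            ((Theta * M%:R)^-1 *: \sum_(0 <= k < M) Vs k)) =
          (Theta * M%:R)^-1 *
          \sum_(0 <= i < M) \sum_(E <- Es i q) NM (c00_restrict E (Vs i)).
        rewrite mulr_sumr; apply: eq_big_nat => i /= ltiM; rewrite mulr_sumr.
        apply: eq_big_seq => E EE; rewrite c00_restrictZ NM_Z ger0_norm; last first.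
          by rewrite invr_ge0 mulr_ge0 // ltW.
        congr (_ * NM _); rewrite c00_restrict_sum.
        rewrite (bigD1_seq i) ?iota_uniq ?mem_index_iota //= big1 ?addr0 // => k ki.
        apply: c00_restrict_eq0 => x xE; apply: contraNeq ki => Vk.
        have [_ Vsupp _ _ _] := gd k; have /andP[k1 k2] := Vsupp _ Vk.
        have /andP[i1 i2] := inEs _ _ _ _ qs EE xE; apply/eqP.
        have [ki|ik|//] := ltngtP k i.
          by have := leq_trans i1 (leq_trans k2 (nn_mono _ _ ki)); rewrite ltnn.
        by have := leq_trans k1 (leq_trans i2 (nn_mono _ _ ik)); rewrite ltnn.
      have -> a : Theta ^+ (nth 0%N hs q).+1 * ((Theta * M%:R)^-1 * a) =
          M%:R^-1 * (Theta ^+ nth 0%N hs q * a).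
        rewrite exprSr; move: (Theta ^+ _) => t.
        by field; rewrite !gt_eqF.
      rewrite ler_pdivlMl // mulr_natl mulr_sumr.
      apply: (@le_trans _ _ (\sum_(0 <= i < M) delta)).
        by rewrite sumr_const_nat subn0.
      by apply: ler_sum => i _; have [] := parts i q qs.
  move=> q q' E F; rewrite size_map => /andP[qq' q's].
  have qs := ltn_trans qq' q's.
  move=> /flattenP[_ /mapP[i _ ->] EE] /flattenP[_ /mapP[k _ ->] FE].
  have [ik|ik|ik] := ltngtP i k; last first.
  + rewrite ik in EE; have [_ _ _ _ [_ dis]] := gd k.
    by apply: dis EE FE; rewrite qq'.
  + apply/fdisjointP => x /(inEs _ _ _ _ qs EE)/andP[i1 _]; apply/negP.
    move=> /(inEs _ _ _ _ q's FE)/andP[_ k2].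
    by have := leq_trans i1 (leq_trans k2 (nn_mono _ _ ik)); rewrite ltnn.
  + apply/fdisjointP => x /(inEs _ _ _ _ qs EE)/andP[_ i2]; apply/negP.
    move=> /(inEs _ _ _ _ q's FE)/andP[k1 _].
    by have := leq_trans k1 (leq_trans i2 (nn_mono _ _ ik)); rewrite ltnn.
Qed.

(** * Rounds of blocks and averages *)

Hypothesis d_lt1 : d < 1.
Hypothesis Theta_lt1 : Theta < 1.

Lemma attainable_ge0 hs b m : attainable hs b -> 0 <= b m.
Proof.
by move=> att; have [[n [[v V] Ess]] [_ _ /split_bound_ge0]] := att 0%N 1 ltr01.
Qed.

(** Every average adds eps and shifts the profile, so after s of them each depth below s was depth 0
    after one of the averages and there gained the factor d. *)
Lemma attainable_averages hs b B eps s : attainable hs b -> (forall m, b m <= B) ->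
  0 < eps -> exists b', [/\ attainable (iter s (map S) hs) b',
    forall m, b' m <= B + s%:R * eps
    & forall m, (m < s)%N -> b' m <= d * (B + s%:R * eps) + s%:R * eps].
Proof.
move=> att bB eps0; have B0 : 0 <= B := le_trans (attainable_ge0 0 att) (bB 0%N).
elim: s => [|s [b' [att' b'B b'low]]].
  by exists b; split=> // m; rewrite mul0r addr0.
have sS : s.+1%:R * eps = s%:R * eps + eps :> R by rewrite -natr1 mulrDl mul1r.
have B'0 : 0 <= B + s%:R * eps by rewrite addr_ge0 // mulr_ge0 // ltW.
exists (fun m => if m is m'.+1 then b' m' + eps else d * (B + s%:R * eps) + eps).
split; first exact: attainable_average att' b'B eps0.
  move=> [|m]; rewrite sS addrA lerD2r //.
  by rewrite ler_piMl // ltW.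
have dS : d * (B + s%:R * eps) <= d * (B + s.+1%:R * eps).
  by rewrite ler_wpM2l // sS addrA lerDl ltW.
move=> [_|m ms]; rewrite {2}sS addrA lerD2r.
  by apply: ler_wpDr dS; rewrite mulr_ge0 // ltW.
by apply: le_trans (b'low m ms) _; rewrite lerD2r.
Qed.

(* Each round adds a block and averages r times, and raises the bound by only   *)
(* e + 2 Theta^r: the block is seen at full size by the depths below r, where   *)
(* the previous averages have already gained the factor d.                      *)
Lemma attainable_rounds K r e : (0 < r)%N -> 0 < e <= 1 ->
  let beta k := 3 / (1 - d) + k%:R * (e + 2 * Theta ^+ r) in
  exists hs b, [/\ size hs = K, all (leq 1) hs, attainable hs b,
    forall m, b m <= beta K & forall m, (m < r)%N -> b m <= d * beta K + e].
Proof.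
move=> r0 /andP[e0 e1] beta.
have d10 : 0 < 1 - d by rewrite subr_gt0.
have t0 : 0 <= e + 2 * Theta ^+ r by rewrite addr_ge0 ?mulr_ge0 // ltW.
have beta0 k : 3 / (1 - d) <= beta k by rewrite lerDl mulr_ge0.
have betap k : 0 <= beta k by apply: le_trans (beta0 k); rewrite divr_ge0 // ltW.
elim: K => [|K [hs [b [szK hsK attK bK lowK]]]].
  exists [::], (fun=> 0); split=> //; first exact: attainable_nil.
  by move=> m _; rewrite addr_ge0 ?mulr_ge0 // ltW.
have er0 : 0 < e / r%:R by rewrite divr_gt0 // ltr0n.
have rer : r%:R * (e / r%:R) = e by rewrite mulrC divfK // pnatr_eq0 -lt0n.
have ThX1 m : Theta ^+ m <= 1 by rewrite exprn_ile1 // ltW.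
have addB m : 2 * Theta ^+ m + b m <= beta K + 2 * Theta ^+ r.
  (* From depth r on the block adds at most 2 Theta^r. Below r there is room for it: 2 + d beta + e
     <= beta, because (1 - d) beta >= 3 and e <= 1. *)
  have [mr|rm] := ltnP m r; last first.
    rewrite addrC lerD // ler_wpM2l // -(subnK rm) exprD ler_piMl //.
  apply: (@le_trans _ _ (2 * 1 + (d * beta K + e))).
    by rewrite lerD ?ler_wpM2l ?lowK.
  apply: (@le_trans _ _ (beta K)); last by rewrite lerDl mulr_ge0.
  rewrite -subr_ge0; have := beta0 K; rewrite ler_pdivrMr //.
  by lra.
have [b' [att' b'B b'low]] := attainable_averages r (attainable_add attK) addB er0.
have betaS : beta K + 2 * Theta ^+ r + e = beta K.+1.
  by rewrite /beta -natr1 mulrDl mul1r; ring.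
have iterE : iter r (map S) (0%N :: hs) = map (addn r) (0%N :: hs).
  elim: r {r0 t0 beta beta0 betap bK lowK er0 rer addB b' att' b'B b'low betaS} =>
    [|r IH].
    by rewrite (eq_map (g := id)) ?map_id.
  by rewrite iterS IH -map_comp; apply: eq_map => x.
rewrite rer betaS in b'B b'low.
exists (iter r (map S) (0%N :: hs)), b'; split=> //.
  by rewrite iterE size_map /= szK.
rewrite iterE; apply/allP => _ /mapP[h _ ->]; exact: leq_trans (leq_addr _ _).
Qed.

(** * The lower bound from intertwined parts *)

Variable c : R.
Hypothesis c_ge0 : 0 <= c.
Hypothesis theta_ge : forall k, (0 < k)%N -> c * Theta ^+ k <= theta k.

(** On its own union [F q], each part has norm at least c delta, since its family of depth h >= 1
    has weight at least c Theta^h. The sets [F q] are disjoint and lie beyond [m >= size hs], so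
    they form an S_1-allowable family. *)
Lemma modified_norm_ge_parts hs m n V Ess : has_parts hs m n V Ess ->
  all (leq 1) hs -> (size hs <= m)%N ->
  theta 1 * ((size hs)%:R * (c * delta)) <= NM V.
Proof.
move=> [parts disj] /allP hs1 szm.
pose F q := (\bigcup_(E <- Ess q) E)%fset.
have FP q x : reflect (exists2 E, E \in Ess q & x \in E) (x \in F q).
  exact: bigcup_fsetP.
have Fgt q x : (q < size hs)%N -> x \in F q -> (m < x)%N.
  move=> qs /FP[E EE xE]; have [_ h _] := parts q qs.
  by have := h _ EE _ xE; rewrite in_fset_interval => /andP[].
have F0 q : (q < size hs)%N -> F q != fset0.
  move=> qs; have [[/allP nE _ _] _ dE] := parts q qs.
  case EE : (Ess q) nE dE => [|E Es] nE.
    by rewrite big_nil mulr0 leNgt delta_gt0.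
  move=> _; have /andP[/fset0Pn[x xE] _] := nE E (mem_head _ _).
  by apply/fset0Pn; exists x; apply/FP; exists E => //; rewrite EE mem_head.
pose Fs := [seq F q | q <- iota 0 (size hs)].
have FsP G : G \in Fs -> exists2 q, (q < size hs)%N & G = F q.
  by move=> /mapP[q]; rewrite mem_iota => qs ->; exists q.
have aFs : allowable 1 Fs.
  have nFs : all nonempty_index_set Fs.
    apply/allP => _ /FsP[q qs ->]; apply/andP; split; first exact: F0.
    by apply/negP => /(Fgt _ _ qs).
  split=> //.
    apply/(pairwiseP fset0) => i j; rewrite !inE size_map size_iota => si sj ij.
    rewrite !(nth_map 0%N) ?size_iota // !nth_iota //.
    apply/fdisjointP => x /FP[E EE xE]; apply/negP => /FP[G GE xG].
    have /fdisjointP/(_ _ xE) : [disjoint E & G]%fset.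
      by apply: disj EE GE; rewrite ij.
    by rewrite xG.
  have gtm x : x \in min_set Fs -> (m < x)%N.
    by move=> /min_setP[_ /FsP[q qs ->] ->]; apply: (Fgt q) => //; exact/fmin_in/F0.
  have [->|mn0] := eqVneq (min_set Fs) fset0; first by left.
  apply: schreier1; first by apply/negP => /gtm.
  apply: leq_trans (card_min_set_leq Fs) _; rewrite size_map size_iota.
  exact: leq_trans szm (ltnW (gtm _ (fmin_in mn0))).
have := modified_norm_ge (k := 1) V isT aFs; apply: le_trans.
rewrite ler_wpM2l //; first by have /andP[] := theta01 (ltn0Sn 0).
rewrite big_map -{1}(size_iota 0 (size hs)) -sumr_const_list.
rewrite big_seq [leRHS]big_seq; apply: ler_sum => q; rewrite mem_iota => qs.
have [aE _ dE] := parts q qs.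
have hq : (0 < nth 0 hs q)%N by apply: hs1; exact: mem_nth.
have := modified_norm_ge (c00_restrict (F q) V) hq (admissible_allowable aE).
apply: le_trans; under eq_big_seq => E EE.
  rewrite c00_restrictI (fsetIidPl _); last first.
    by apply/fsubsetP => x xE; apply/FP; exists E.
over.
apply: (@le_trans _ _ (c * Theta ^+ nth 0%N hs q *
    \sum_(E <- Ess q) NM (c00_restrict E V))).
  by rewrite -mulrA ler_wpM2l.
rewrite ler_wpM2r ?theta_ge //; apply: sumr_ge0 => E _.
by rewrite -iM_norm.
Qed.

Lemma far_apart_norms K : exists v V,
  [/\ N v <= 3 / (1 - d) + 1, `|T v - iM V| <= 1
    & theta 1 * (K%:R * (c * delta)) <= NM V].
Proof.
(* With 2 Theta^r <= e, the K rounds cost at most 2 K e = K / (K + 1) <= 1. *)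
pose e := (2 * K.+1%:R)^-1 : R.
have K0 : 0 < 2 * K.+1%:R :> R by rewrite mulr_gt0 // ltr0n.
have e0 : 0 < e by rewrite invr_gt0.
have e1 : e <= 1.
  by rewrite invf_le1 // -natrM ler1n.
have [r r0 Thr] : exists2 r, (0 < r)%N & 2 * Theta ^+ r <= e.
  have e20 : 0 < e / 2 by rewrite divr_gt0.
  have ThC : Theta ^+ n @[n --> \oo] --> (0 : R).
    by apply: cvg_expr; rewrite ger0_norm // ltW.
  have [n _ nP] := cvgr0_norm_lt _ ThC _ e20.
  exists n.+1 => //; rewrite -ler_pdivlMl // mulrC ltW //.
  by have := nP n.+1 (leqnSn n); rewrite ger0_norm.
have [hs [b [szK hsK attK bK _]]] :=
  attainable_rounds K r0 (introT andP (conj e0 e1)).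
(* Starting beyond K makes the K parts S_1-allowable; starting beyond 1 allows v itself as a single
   piece. *)
have [[n [[v V] Ess]] [[mn vs] Vs bv TV partsV]] := attK (maxn K 1) 1 ltr01.
exists v, V; split=> //.
  have := bv 0%N [:: [:: fset_interval (maxn K 1) n]]; rewrite /= big_seq1 expr0 mul1r.
  rewrite c00_restrict_id => [h|x /vs]; last by rewrite in_fset_interval.
  apply: le_trans (h _ _ isT) (le_trans (bK 0%N) _).
  - by rewrite leq_max orbT.
  - by move=> Es; rewrite inE => /eqP->.
  - rewrite lerD2l; apply: (@le_trans _ _ (K%:R * (e + e))).
      by rewrite ler_wpM2l // lerD2l.
    rewrite -mulr2n -[e *+ 2]mulr_natl /e invfM mulVKf ?pnatr_eq0 //.
    by rewrite ler_pdivrMr ?ltr0n // mul1r ler_nat.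
rewrite -szK; apply: modified_norm_ge_parts partsV hsK _.
by rewrite szK leq_maxl.
Qed.

End Transfer.

End Construction.

(** * The contradiction with an isomorphism *)

Lemma continuous_linear_le (R : realType) (V W : normedModType R)
    (f : {linear V -> W}) : continuous f ->
  exists2 C, 0 < C & forall x, `|f x| <= C * `|x|.
Proof.
move=> /linear_bounded_continuous/linear_boundedP [M [_ MP]].
exists (Num.max M 0 + 1); first by rewrite ltr_wpDl // le_max lexx orbT.
by apply: MP; rewrite ltr_pwDr // le_max lexx.
Qed.

Theorem theorem22 (R : realType) (theta : nat -> R)
    (theta_regular : regular theta)
    (theta_null : theta n @[n --> \oo] --> (0 : R))
    (root_sup_lt1 : root_sup theta < 1)
    (inf_phi : 0 < inf (phi_values theta) <= sup (phi_values theta))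
    (sup_phi : sup (phi_values theta) < 1)
    (X X_M : completeNormedModType R)
    (X_T : is_mixed_tsirelson theta X)
    (X_M_T : is_modified_mixed_tsirelson theta X_M) :
  ~ isomorphic X X_M.
Proof.
case: theta_regular => th01 _ _; set Th := root_sup theta in root_sup_lt1.
set c := inf _ in inf_phi; set d := sup _ in inf_phi sup_phi.
have /andP[c0 cd] := inf_phi.
have d0 : 0 < d := lt_le_trans c0 cd.
(* A missing supremum or infimum would have the default value 0, against 0 < c <= d. *)
have [hsup hinf] : has_sup (phi_values theta) /\ has_inf (phi_values theta).
  split; apply: contrapT; last by move=> /inf_out h; rewrite /c h ltxx in c0.
  by move=> /sup_out h; rewrite /d h ltxx in d0.
have phi_c k : (0 < k)%N -> c <= phi theta k.
  by move=> k0; apply: ge_inf; [case: hinf|exists k].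
have phi_d k : (0 < k)%N -> phi theta k <= d.
  by move=> k0; apply: ub_le_sup; [case: hsup|exists k].
have Th0 : 0 < Th.
  have := lt_le_trans c0 (phi_c 1%N isT); rewrite /phi expr1 -/Th pmulr_rgt0 ?invr_gt0 //.
  by case/andP: (th01 1%N isT).
have ThX k : 0 < Th ^+ k by rewrite exprn_gt0.
have thge k : (0 < k)%N -> c * Th ^+ k <= theta k.
  by move=> /phi_c; rewrite /phi -/Th ler_pdivlMr.
have thle k : (0 < k)%N -> theta k <= d * Th ^+ k.
  by move=> /phi_d; rewrite /phi -/Th ler_pdivrMr.
have th01w k : (0 < k)%N -> 0 <= theta k <= 1.
  by move=> /th01/andP[/ltW-> /ltW->].
move: X_T X_M_T => [i [iN _]] [iM [iMN iMd]] [f [g [fK _ fc gc]]].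
have [Cf Cf0 fle] := continuous_linear_le fc.
have [Cg Cg0 gle] := continuous_linear_le gc.
pose T : {linear c00 R -> X_M} := f \o i.
have TE v : T v = f (i v) by [].
have NXD x y : tsirelson_norm theta (x + y) <=
    tsirelson_norm theta x + tsirelson_norm theta y.
  by rewrite -!iN linearD ler_normD.
have NXZ a x : tsirelson_norm theta (a *: x) = `|a| * tsirelson_norm theta x.
  by rewrite -!iN linearZZ normrZ.
(* Half of the separation 1 / Cg: [g] sends the image of a difference of distinct unit vectors back
   to that difference, which has a coordinate 1. *)
pose delta := (2 * Cg)^-1.
have delta0 : 0 < delta by rewrite invr_gt0 mulr_gt0.
have Tunit j : `|T (c00_unit R j)| <= Cf.
  by rewrite TE (le_trans (fle _)) // ler_piMr ?(ltW Cf0) // iN norm_unit.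
have Tsep j j' : j != j' -> 2 * delta <= `|T (c00_unit R j - c00_unit R j')|.
  move=> jj'; have -> : 2 * delta = Cg^-1 by rewrite /delta invfM mulVKf.
  rewrite -[leLHS]mulr1 ler_pdivrMl //; apply: le_trans (gle _); rewrite TE fK iN.
  apply: le_trans (coord_le_norm th01w _ j.+1).
  by rewrite c00D c00N !c00_unitE eqxx eqSS (negPf jj') subr0 normr1.
have blocks := exists_far_block th01w iMN iMd delta0 Tunit Tsep.
have th1 : 0 < theta 1%N by case/andP: (th01 1%N isT).
have cdel : 0 < theta 1%N * (c * delta) by rewrite !mulr_gt0.
(* This bounds the modified norm of V for every K: the norm of v, times Cf, plus the distance 1
   between T v and V. Then K is chosen to exceed it. *)
pose bound := Cf * (3 / (1 - d) + 1) + 1.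
pose K := (Num.truncn (bound / (theta 1%N * (c * delta)))).+1.
have [v [V [Nv TV NV]]] := far_apart_norms th01w thle Th0 (ltW d0) NXD NXZ iMN
  delta0 blocks sup_phi root_sup_lt1 (ltW c0) thge K.
have : bound < theta 1%N * (K%:R * (c * delta)).
  rewrite mulrCA -ltr_pdivrMr //; exact: truncnS_gt.
apply/negP; rewrite -leNgt; apply: le_trans NV _; rewrite -iMN.
rewrite -[iM V](subrKC (T v)); apply: le_trans (ler_normD _ _) _.
rewrite lerD //; last by rewrite distrC.
by rewrite TE (le_trans (fle _)) // iN ler_wpM2l // ltW.
Qed.
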